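(* Let $P_i=(x_i:y_i:z_i)$, $i=1,\dots,8$, be eight distinct points in the projective plane $\mathbb{P}^2$, no three on a line and no six on a conic, and let $P_9=(x_9:y_9:z_9)$ be their Cayley-Bacharach point. Put \begin{align*} C_x &= C(P_1, P_4, P_5, P_6, P_7, P_8), & D_x &= D(P_1; P_2, P_3, P_4, P_5, P_6, P_7, P_8),\\ C_y &= C(P_2, P_4, P_5, P_6, P_7, P_8), & D_y &= D(P_2; P_3, P_1, P_4, P_5, P_6, P_7, P_8),\\ C_z &= C(P_3, P_4, P_5, P_6, P_7, P_8), & D_z &= D(P_3; P_1, P_2, P_4, P_5, P_6, P_7, P_8). \end{align*} Then the Cayley-Bacharach point is given by the formula $$P_9 \;=\; C_xD_yD_z \cdot P_1 + D_xC_yD_z \cdot P_2 + D_xD_yC_z \cdot P_3 .$$ Equivalently, the (homogeneous) coordinates of $P_9$ are the rational functions \begin{align*} x_9 &= C_xD_yD_zx_1 + D_xC_yD_zx_2 + D_xD_yC_zx_3, \\ y_9 &= C_xD_yD_zy_1 + D_xC_yD_zy_2 + D_xD_yC_zy_3, \\ z_9 &= C_xD_yD_zz_1 + D_xC_yD_zz_2 + D_xD_yC_zz_3. \end{align*}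
   Context: Cayley-Bacharach point. If $P_1,\dots,P_8$ are eight distinct points in $\mathbb{P}^2$, no three on a line and no six on a conic, then there is a unique ninth point $P_9$ such that every cubic curve through $P_1,\dots,P_8$ also contains $P_9$; it is the ninth intersection point of any two distinct cubics through $P_1,\dots,P_8$. It is called the Cayley-Bacharach point of $P_1,\dots,P_8$. In the formula, each $P_i$ stands for the vector of homogeneous coordinates $(x_i,y_i,z_i)$, and the right-hand side is a vector of homogeneous coordinates for $P_9$. Polynomials $C$ and $D$. For $Q_i=(x_i,y_i,z_i)$, let $$C(Q_1,\dots,Q_6)=\det\big(x_i^2,\; x_iy_i,\; x_iz_i,\; y_i^2,\; y_iz_i,\; z_i^2\big)_{i=1,\dots,6},$$ the determinant of the $6\times 6$ matrix whose $i$-th row is displayed; its vanishing is the condition for the six points to lie on a conic. Let $D(Q_1;Q_2,\dots,Q_8)$ be the determinant of the $10\times10$ matrix whose first seven rows are, for $i=2,3,\dots,8$ in this order, $$(x_i^3,\; x_i^2y_i,\; x_i^2z_i,\; x_iy_i^2,\; x_iy_iz_i,\; x_iz_i^2,\; y_i^3,\; y_i^2z_i,\; y_iz_i^2,\; z_i^3),$$ and whose last three rows are \begin{align*} &(3x_1^2,\; 2x_1y_1,\; 2x_1z_1,\; y_1^2,\; y_1z_1,\; z_1^2,\; 0,\; 0,\; 0,\; 0),\\ &(0,\; x_1^2,\; 0,\; 2x_1y_1,\; x_1z_1,\; 0,\; 3y_1^2,\; 2y_1z_1,\; z_1^2,\; 0),\\ &(0,\; 0,\; x_1^2,\; 0,\;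 x_1y_1,\; 2x_1z_1,\; 0,\; y_1^2,\; 2y_1z_1,\; 3z_1^2). \end{align*} It expresses the condition that the eight points lie on a cubic curve that is singular at the first point $Q_1$. For other arguments, such as $C(P_1,P_4,P_5,P_6,P_7,P_8)$ or $D(P_2;P_3,P_1,P_4,\dots,P_8)$, substitute the listed vectors for $Q_1,Q_2,\dots$ in the listed order. Both $C$ and $D$ are homogeneous polynomials with integer coefficients in the coordinates of the points. *)

(* Defs.v *)
From mathcomp Require Import all_boot all_order all_algebra.
From mathcomp Require Import mpoly.

Set Implicit Arguments.
Unset Strict Implicit.
Unset Printing Implicit Defensive.

Import GRing.Theory.
Local Open Scope ring_scope.

Local Notation "x %:F" := (tofrac x) : ring_scope.

(* A point of the projective plane over K is given by a nonzero row vector of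
   homogeneous coordinates; two such vectors represent the same point iff they
   span the same line of K^3. *)
Definition same_point (K : fieldType) (P Q : 'rV[K]_3) : bool := (P == Q)%MS.

(* F = 0 is a plane curve of degree d, possibly reducible or non-reduced. *)
Definition curve (K : fieldType) (d : nat) (F : {mpoly K[3]}) : Prop :=
  F != 0 /\ F \is d.-homog.

Definition passes (K : fieldType) (F : {mpoly K[3]}) (Q : 'rV[K]_3) : Prop :=
  F.@[Q 0] = 0.

Definition on_common_curve (K : fieldType) (n d : nat)
    (P : n.-tuple 'rV[K]_3) (A : {set 'I_n}) : Prop :=
  exists2 F : {mpoly K[3]}, curve d F & {in A, forall i, passes F (tnth P i)}.

Definition general_position (K : fieldType) (P : 8.-tuple 'rV[K]_3) : Prop :=
  [/\ forall i j : 'I_8, i != j -> ~~ same_point (tnth P i) (tnth P j),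
      forall A : {set 'I_8}, #|A| = 3%N -> ~ on_common_curve 1 P A
    & forall A : {set 'I_8}, #|A| = 6%N -> ~ on_common_curve 2 P A].

(* The local ring of the projective plane at Q, inside the field of fractions
   of K[x, y, z]: quotients of forms of the same degree whose denominator does
   not vanish at Q. *)
Definition local_ring (K : fieldType) (Q : 'rV[K]_3)
    (r : {fraction {mpoly K[3]}}) : Prop :=
  exists d : nat, exists a b : {mpoly K[3]},
    [/\ a \is d.-homog, b \is d.-homog, b.@[Q 0] != 0
      & r = a%:F / b%:F].

(* The ideal of the local ring at Q generated by local equations F / H and
   G / H' of two curves, H and H' being forms of degree deg F and deg G that do
   not vanish at Q; the combinations are reduced to a common denominator. *)
Definition local_ideal (K : fieldType) (Q : 'rV[K]_3) (F G : {mpoly K[3]})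
    (r : {fraction {mpoly K[3]}}) : Prop :=
  exists d : nat, exists a b c : {mpoly K[3]},
    [/\ a * F \is d.-homog, b * G \is d.-homog, c \is d.-homog,
        c.@[Q 0] != 0
      & r = (a * F + b * G)%:F / c%:F].

(* The intersection multiplicity of F and G at Q is m: the K-vector space
   local_ring Q / local_ideal Q F G has a basis of m elements, the classes of
   the e i. *)
Definition intersection_multiplicity (K : fieldType) (Q : 'rV[K]_3)
    (F G : {mpoly K[3]}) (m : nat) : Prop :=
  exists2 e : 'I_m -> {fraction {mpoly K[3]}},
    forall i, local_ring Q (e i)
  & forall r, local_ring Q r ->
      exists! k : 'rV[K]_m,
        local_ideal Q F G (r - \sum_(i < m) ((k 0 i)%:MP)%:F * e i).

Definition cubic_through (K : fieldType) (P : 8.-tuple 'rV[K]_3)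
    (F : {mpoly K[3]}) : Prop :=
  curve 3 F /\ forall i : 'I_8, passes F (tnth P i).

(* The ninth intersection point is counted with multiplicity: P9 may coincide
   with one of the eight given points, at which any two of the cubics are then
   tangent. Two cubics are distinct curves iff their equations are not
   proportional. *)
Definition Cayley_Bacharach_point (K : fieldType) (P : 8.-tuple 'rV[K]_3)
    (P9 : 'rV[K]_3) : Prop :=
  [/\ P9 != 0,
      forall F : {mpoly K[3]}, cubic_through P F -> passes F P9
    & forall F G : {mpoly K[3]}, cubic_through P F -> cubic_through P G ->
        (forall k : K, G != k *: F) ->
        forall Q : 'rV[K]_3, Q != 0 ->
          intersection_multiplicity Q F G
            (#|[set i : 'I_8 | same_point (tnth P i) Q]| + same_point P9 Q)%N].

Definition row_of_seq (K : fieldType) (n : nat) (s : seq K) : 'rV[K]_n :=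
  \row_(j < n) s`_j.

Definition quadratic_monomials (K : fieldType) (Q : 'rV[K]_3) : 'rV[K]_6 :=
  let x := Q 0 0 in let y := Q 0 1 in let z := Q 0 2 in
  row_of_seq 6 [:: x ^+ 2; x * y; x * z; y ^+ 2; y * z; z ^+ 2].

Definition cubic_monomials (K : fieldType) (Q : 'rV[K]_3) : 'rV[K]_10 :=
  let x := Q 0 0 in let y := Q 0 1 in let z := Q 0 2 in
  row_of_seq 10 [:: x ^+ 3; x ^+ 2 * y; x ^+ 2 * z; x * y ^+ 2; x * y * z;
                    x * z ^+ 2; y ^+ 3; y ^+ 2 * z; y * z ^+ 2; z ^+ 3].

Definition cubic_monomials_dx (K : fieldType) (Q : 'rV[K]_3) : 'rV[K]_10 :=
  let x := Q 0 0 in let y := Q 0 1 in let z := Q 0 2 in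
  row_of_seq 10 [:: 3 * x ^+ 2; 2 * x * y; 2 * x * z; y ^+ 2; y * z;
                    z ^+ 2; 0; 0; 0; 0].

Definition cubic_monomials_dy (K : fieldType) (Q : 'rV[K]_3) : 'rV[K]_10 :=
  let x := Q 0 0 in let y := Q 0 1 in let z := Q 0 2 in
  row_of_seq 10 [:: 0; x ^+ 2; 0; 2 * x * y; x * z;
                    0; 3 * y ^+ 2; 2 * y * z; z ^+ 2; 0].

Definition cubic_monomials_dz (K : fieldType) (Q : 'rV[K]_3) : 'rV[K]_10 :=
  let x := Q 0 0 in let y := Q 0 1 in let z := Q 0 2 in
  row_of_seq 10 [:: 0; 0; x ^+ 2; 0; x * y;
                    2 * x * z; 0; y ^+ 2; 2 * y * z; 3 * z ^+ 2].

Definition Cdet (K : fieldType) (Q1 Q2 Q3 Q4 Q5 Q6 : 'rV[K]_3) : K :=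
  \det (\matrix_(i < 6)
    quadratic_monomials (tnth [tuple Q1; Q2; Q3; Q4; Q5; Q6] i)).

(* By Euler's identity the last three rows, weighted by the coordinates of Q1,
   sum to 3 * cubic_monomials Q1; so this determinant vanishes identically in
   characteristic 3. *)
Definition Ddet (K : fieldType) (Q1 Q2 Q3 Q4 Q5 Q6 Q7 Q8 : 'rV[K]_3) : K :=
  \det (\matrix_(i < 10)
    tnth [tuple cubic_monomials Q2; cubic_monomials Q3; cubic_monomials Q4;
                cubic_monomials Q5; cubic_monomials Q6; cubic_monomials Q7;
                cubic_monomials Q8; cubic_monomials_dx Q1;
                cubic_monomials_dy Q1; cubic_monomials_dz Q1] i).

(* Main.v *)
Require Import Defs.
From mathcomp Require Import all_boot all_order all_algebra.
From mathcomp Require Import mpoly perm.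
From mathcomp Require Import ring.

(* Let f, g span the pencil of cubics through P1, ..., P8 and let Ji be the Jacobian of f and g at
   Pi.  Then Dx, Dy, Dz are proportional to J1, J2, J3, and Ji = 0 iff f and g are tangent at Pi iff
   P9 = Pi, which settles the case where P9 is one of P1, P2, P3.  Otherwise
   P9 = X P1 + Y P2 + Z P3 with X Y Z <> 0, and f = A l + B l', g = A k + B k' for two conics A, B
   through P1, P2, P3, P9 and linear forms l, l', k, k'.  The points P4, ..., P8 are linked to
   P1, P2, P3, P9 by f and g, so they lie on the conic l k' - l' k (by tangency, also the one that
   P9 may coincide with).  Its values at P1, P2, P3 are proportional to X J1, Y J2, Z J3, but also
   to Cx, Cy, Cz, which gives the formula. *)

Set Implicit Arguments.
Unset Strict Implicit.
Unset Printing Implicit Defensive.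

Import GRing.Theory.
Local Open Scope ring_scope.

Local Notation "x %:F" := (tofrac x) : ring_scope.

(** * Local intersection multiplicity *)

(** Bezout's theorem is not invoked: intersection multiplicities enter only at the points Pi, and
    only through the dichotomy between multiplicity 1 and multiplicity 2, that is, between
    independent and dependent gradients. The rest is linear algebra and polynomial identities on
    coefficient vectors. General position makes the eight evaluation rows independent, so they
    extend to an invertible 10 x 10 matrix W, and f, g are two columns of its inverse. Multiplying
    the matrix of Dx by that inverse leaves a 3 x 3 determinant of gradients, whence Dx times
    [det3 P1 P2 P3] is 3 J1 det W. The 3 is Euler's, and is why characteristic 3 is excluded.
    Rotating P1, P2, P3 cyclically changes neither determinant, so Dx, Dy, Dz are J1, J2, J3 times
    one common mu. When P9 is none of P1, P2, P3, also Cx, Cy, Cz are X J1, Y J2, Z J3 times one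
    common nu, so the three coefficients of the formula are X, Y, Z times mu^2 nu J1 J2 J3. *)

Lemma mnm_subUU (n : nat) (i : 'I_n) : (U_(i) - U_(i))%MM = 0%MM.
Proof. by apply/mnmP => j; rewrite mnmBE subnn mnm0E. Qed.

Lemma mdegS_split (n d : nat) (m : 'X_{1..n}) :
  mdeg m = d.+1 -> exists i m', m = (U_(i) + m')%MM /\ mdeg m' = d.
Proof.
move=> hm; have [/existsP[i hi]|] := boolP [exists i, m i != 0%N].
  have e : m = (U_(i) + (m - U_(i)))%MM by rewrite addmC submK // lep1mP.
  exists i, (m - U_(i))%MM; split=> //.
  by move: hm; rewrite {1}e mdegD mdeg1 => -[].
rewrite negb_exists => /forallP h0.
by move: hm; rewrite mdegE big1 // => i _; apply/eqP; have := h0 i; rewrite negbK.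
Qed.

(** Modulo the forms X_j - r_j X_k every X_j becomes r_j X_k. The cofactors are kept homogeneous
    because [local_ideal] only admits homogeneous combinations. *)
Lemma monomial_mod_point (K : fieldType) (n d : nat) (r : 'I_n -> K) (k : 'I_n)
    (m : 'X_{1..n}) :
  mdeg m = d.+1 ->
  exists2 c : 'I_n -> {mpoly K[n]}, forall j, c j \is d.-homog &
    'X_[m] = 'X_[m].@[r] *: 'X_k ^+ d.+1 + \sum_j ('X_j - r j *: 'X_k) * c j.
Proof.
elim: d m => [|d IH] m hm; have [i [m' [-> hm']]] := mdegS_split hm.
  have -> : m' = 0%MM by apply/eqP; rewrite -mdeg_eq0 hm'.
  exists (fun j => ((j == i)%:R)%:MP) => [j|].
    by rewrite -[_%:MP]mulr1 mul_mpolyC dhomogZ ?dhomog1.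
  rewrite addm0 mevalXU (bigD1 i) //= eqxx mulr1 big1 => [|j /negPf->].
    by rewrite addr0 addrC subrK.
  by rewrite mpolyC0 mulr0.
have [c hc ec] := IH _ hm'.
(* With v the value of X^m' at r, X_i X^m' is X_i (X^m' - v X_k^(d+1)) + v (X_i - r_i X_k) X_k^(d+1)
   + v r_i X_k^(d+2). *)
exists (fun j => 'X_i * c j + ((j == i)%:R * 'X_[m'].@[r]) *: 'X_k ^+ d.+1) => [j|].
  apply: dhomogD; first by rewrite -add1n; apply: dhomogM => //; rewrite dhomogX /= mdeg1.
  apply: dhomogZ; have := @dhomogMn _ _ mdeg 1 ('X_k : {mpoly K[n]}) d.+1.
  by rewrite mul1n => -> //; rewrite dhomogX /= mdeg1.
rewrite mpolyXD mevalM mevalXU {1}ec.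
under [X in _ = _ + X]eq_bigr do rewrite mulrDr mulrCA.
rewrite big_split /= -mulr_sumr [X in _ = _ + (_ + X)](bigD1 i) //= eqxx mul1r.
rewrite [X in _ = _ + (_ + (_ + X))]big1 => [|j /negPf->]; last first.
  by rewrite mul0r scale0r mulr0.
rewrite addr0 mulrDr -!mul_mpolyC mpolyCM !exprS; ring.
Qed.

Lemma homog_mod_point (K : fieldType) (n d : nat) (r : 'I_n -> K) (k : 'I_n)
    (p : {mpoly K[n]}) :
  p \is d.+1.-homog ->
  exists2 c : 'I_n -> {mpoly K[n]}, forall j, c j \is d.-homog &
    p = p.@[r] *: 'X_k ^+ d.+1 + \sum_j ('X_j - r j *: 'X_k) * c j.
Proof.
move=> /dhomogP hp; rewrite [p]mpolyE big_seq.
pose S (q : {mpoly K[n]}) := exists2 c : 'I_n -> {mpoly K[n]}, forall j, c j \is d.-homog &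
    q = q.@[r] *: 'X_k ^+ d.+1 + \sum_j ('X_j - r j *: 'X_k) * c j.
apply: (big_ind S) => [|x y [c hc ec] [c' hc' ec']|m /hp hm]; rewrite /S.
- exists (fun=> 0) => [j|]; first exact: dhomog0.
  by rewrite meval0 scale0r big1 ?addr0 // => j _; rewrite mulr0.
- exists (fun j => c j + c' j) => [j|]; first exact: dhomogD.
  under eq_bigr do rewrite mulrDr.
  by rewrite mevalD big_split scalerDl addrACA /= -ec -ec'.
- have [c hc ec] := monomial_mod_point r k hm.
  exists (fun j => p@_m *: c j) => [j|]; first exact: dhomogZ.
  under eq_bigr do rewrite -scalerAr.
  by rewrite -scaler_sumr mevalZ -scalerA -scalerDr -ec.
Qed.

(** The forms X_j - (Q_j / Q_k) X_k vanish at Q, so evaluating the decomposition there leaves only a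
    constant times Q_k^(d+1), and that constant must be zero. *)
Lemma homog_vanish_decomp (K : fieldType) (n d : nat) (Q : 'I_n -> K) (k : 'I_n)
    (p : {mpoly K[n]}) :
  Q k != 0 -> p \is d.+1.-homog -> p.@[Q] = 0 ->
  exists2 c : 'I_n -> {mpoly K[n]}, forall j, c j \is d.-homog &
    p = \sum_j ('X_j - (Q j / Q k) *: 'X_k) * c j.
Proof.
move=> Qk hp p0; have [c hc ec] := homog_mod_point (fun j => Q j / Q k) k hp.
exists c => //; move: p0; rewrite {1}ec mevalD mevalZ rmorphXn /= mevalXU.
rewrite rmorph_sum big1 => [|j _]; last first.
  by rewrite rmorphM /= mevalB mevalZ !mevalXU divfK // subrr mul0r.
rewrite addr0 => /eqP; rewrite mulf_eq0 expf_eq0 (negPf Qk) andbF orbF => /eqP e0.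
by rewrite {1}ec e0 scale0r add0r.
Qed.


(** At Q only the terms where the linear factor is differentiated survive. So the cofactors of a
    form at Q are its partial derivatives, which turns a determinant of cofactors into a
    Jacobian. *)
Lemma mderiv_decomp (K : fieldType) (n : nat) (Q : 'I_n -> K) (k i : 'I_n)
    (c : 'I_n -> {mpoly K[n]}) :
  Q k != 0 -> i != k ->
  ((\sum_j ('X_j - (Q j / Q k) *: 'X_k) * c j)^`M(i)).@[Q] = (c i).@[Q].
Proof.
move=> Qk ik; rewrite (linear_sum (mderiv i)) (raddf_sum (meval Q)) /=.
have e j : ((('X_j - (Q j / Q k) *: 'X_k) * c j)^`M(i)).@[Q] = (j == i)%:R * (c j).@[Q].
  rewrite mderivM mevalD !mevalM mevalB mevalZ !mevalXU divfK // subrr mul0r addr0.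
  rewrite mderivB mderivZ !mderivX !mnm1E [k == i]eq_sym (negPf ik) scale0r scaler0 subr0.
  case: eqP => [->|]; last by rewrite scale0r meval0 !mul0r.
  by rewrite mnm_subUU scale1r mpolyX0 meval1 !mul1r.
by rewrite (eq_bigr _ (fun j _ => e j)) (bigD1 i) //= eqxx mul1r big1 ?addr0 // => j /negPf->;
  rewrite mul0r.
Qed.

(* Write F = sum m_j A_j, G = sum m_j B_j and a = sum m_j c_j with m_j = X_j - (Q_j / Q_k) X_k.
   Cramer's rule puts det(A, B) * a in the ideal (F, G), and det(A, B) at Q is the Jacobian. *)
Lemma local_ideal_of_independent_gradients (K : fieldType) (Q : 'rV[K]_3)
    (dF dG d : nat) (F G a b : {mpoly K[3]}) (k i j : 'I_3) :
  Q 0 k != 0 -> perm_eq [:: k; i; j] (enum 'I_3) ->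
  F \is dF.+1.-homog -> G \is dG.+1.-homog -> F.@[Q 0] = 0 -> G.@[Q 0] = 0 ->
  F^`M(i).@[Q 0] * G^`M(j).@[Q 0] != F^`M(j).@[Q 0] * G^`M(i).@[Q 0] ->
  a \is d.-homog -> b \is d.-homog -> a.@[Q 0] = 0 -> b.@[Q 0] != 0 ->
  local_ideal Q F G (a%:F / b%:F).
Proof.
move=> Qk ijk hF hG F0 G0 nt ha hb a0 b0.
have three (c : 'I_3 -> {mpoly K[3]}) :
    \sum_l ('X_l - (Q 0 l / Q 0 k) *: 'X_k) * c l =
    ('X_i - (Q 0 i / Q 0 k) *: 'X_k) * c i + ('X_j - (Q 0 j / Q 0 k) *: 'X_k) * c j.
  rewrite -big_enum -(perm_big _ ijk) /= !big_cons big_nil.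
  by rewrite divff // scale1r subrr mul0r add0r addr0.
have [ki kj] : i != k /\ j != k.
  have := enum_uniq 'I_3; rewrite -(perm_uniq ijk) /= !inE negb_or ![k == _]eq_sym.
  by case/and3P=> /andP[].
(* The decomposition needs positive degree; in degree 0, [a] is a constant vanishing at Q, hence
   zero. *)
case: d ha hb => [|d] ha hb.
  have [c ac] : exists c, a = c%:MP.
    exists a@_0%MM; apply/mpolyP => m; rewrite mcoeffC.
    have [->|m0] := eqVneq m 0%MM; first by rewrite mulr1.
    by rewrite mulr0 (dhomog_nemf_coeff ha) //= mdeg_eq0.
  move: a0; rewrite ac mevalC => ->.
  exists 0%N, 0, 0, 1; split; rewrite ?mul0r ?dhomog0 ?dhomog1 ?meval1 ?oner_neq0 //.
  by rewrite addr0 raddf0 mul0r.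
have [A hA eA] := homog_vanish_decomp Qk hF F0.
have [B hB eB] := homog_vanish_decomp Qk hG G0.
have [c hc ec] := homog_vanish_decomp Qk ha a0.
have D := fun H l => @mderiv_decomp _ _ (Q 0) k l H Qk.
move: nt; rewrite {1 2}eA {1 2}eB !D // => nt.
rewrite !three in eA eB ec.
pose N := A i * B j - A j * B i.
have hN : N \is (dF + dG).-homog by apply: rpredB; [|rewrite addnC mulrC]; rewrite dhomogM.
exists (dF + dG + d.+1)%N, (c i * B j - c j * B i), (c j * A i - c i * A j), (N * b).
have hM u v (p q r : {mpoly K[3]}) : p \is d.-homog -> q \is u.-homog -> r \is v.+1.-homog ->
    p * q * r \is (v + u + d.+1).-homog.
  move=> hp hq hr; rewrite addnS [(v + u + d)%N]addnC [(v + u)%N]addnC addnA -addnS.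
  by do !apply: dhomogM.
split.
- by rewrite mulrBl; apply: rpredB; apply: hM.
- by rewrite mulrBl [(dF + _)%N]addnC; apply: rpredB; apply: hM.
- exact: dhomogM.
- by rewrite mevalM mulf_neq0 // mevalB !mevalM subr_eq0.
rewrite (_ : _ + _ = N * a); last by rewrite eA eB ec /N; ring.
have N0 : N%:F != 0.
  rewrite tofrac_eq0; apply: contraNneq nt => N0.
  by rewrite -subr_eq0 -!mevalM -mevalB -/N N0 meval0.
by rewrite !tofracM invfM mulrACA divff ?mul1r.
Qed.

Lemma local_ideal_num (K : fieldType) (Q : 'rV[K]_3) (F G : {mpoly K[3]}) r :
  local_ideal Q F G r -> exists a b c, c.@[Q 0] != 0 /\ r * c%:F = (a * F + b * G)%:F.
Proof.
case=> d [a [b [c [_ _ _ c0 ->]]]]; exists a, b, c; split=> //.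
by rewrite divfK // tofrac_eq0; apply: contraNneq c0 => ->; rewrite meval0.
Qed.

Lemma add_scaled_fractions (L : fieldType) (x0 x1 y0 y1 z0 z1 : L) :
  z0 != 0 -> z1 != 0 ->
  x0 * (y0 / z0) + x1 * (y1 / z1) = (x0 * (y0 * z1) + x1 * (y1 * z0)) / (z0 * z1).
Proof. by move=> nz0 nz1; field; rewrite nz0 nz1. Qed.

(** Eliminates the unknown basis element [e] between the relations for l / x and for 1. *)
Lemma clear_fractions (L : fieldType) (x l s0 s e c0 c : L) :
  x != 0 ->
  x * (s0 * c0 * ((l / x - s * e) * c) - s * c * ((1 - s0 * e) * c0)) =
  (s0 * l - s * x) * (c * c0).
Proof. by move=> nx; field. Qed.

(* Two elements of a basis have a nontrivial combination that vanishes at Q; if the gradients were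
   independent it would be in the ideal, against uniqueness of coordinates. *)
Lemma multiplicity_ge2_tangent (K : fieldType) (Q : 'rV[K]_3)
    (dF dG m : nat) (F G : {mpoly K[3]}) (k i j : 'I_3) :
  Q 0 k != 0 -> perm_eq [:: k; i; j] (enum 'I_3) ->
  F \is dF.+1.-homog -> G \is dG.+1.-homog -> F.@[Q 0] = 0 -> G.@[Q 0] = 0 ->
  intersection_multiplicity Q F G m.+2 ->
  F^`M(i).@[Q 0] * G^`M(j).@[Q 0] = F^`M(j).@[Q 0] * G^`M(i).@[Q 0].
Proof.
move=> Qk ijk hF hG F0 G0 [e he hm]; apply/eqP/negPn/negP => nt.
pose i1 : 'I_m.+2 := lift ord0 ord0.
have [d0 [a0 [b0 [ha0 hb0 nb0 e0]]]] := he ord0.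
have [d1 [a1 [b1 [ha1 hb1 nb1 e1]]]] := he i1.
(* A nonzero vector in the kernel of evaluation at Q, after reducing the two basis elements to the
   common denominator b0 b1. *)
have [[k0 k1] /= nk hk] : exists2 k : K * K, k != 0 &
    k.1 * (a0 * b1).@[Q 0] + k.2 * (a1 * b0).@[Q 0] = 0.
  have [z|nz] := eqVneq (a0 * b1).@[Q 0] 0.
    by exists (1, 0); rewrite ?z ?mulr0 ?mul0r ?addr0 // xpair_eqE oner_eq0.
  exists (- (a1 * b0).@[Q 0], (a0 * b1).@[Q 0]); last by rewrite mulNr mulrC addNr.
  by rewrite xpair_eqE (negPf nz) andbF.
have nF b : b.@[Q 0] != 0 -> b%:F != 0.
  by move=> nb; rewrite tofrac_eq0; apply: contraNneq nb => ->; rewrite meval0.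
have [k' [_ ku]] : exists! k : 'rV[K]_m.+2,
    local_ideal Q F G (0 - \sum_(i < m.+2) ((k 0 i)%:MP)%:F * e i).
  by apply: hm; exists 0%N, 0, 1; rewrite dhomog0 dhomog1 meval1 oner_neq0 raddf0 mul0r.
have k_0 : k' = 0.
  apply: ku; exists 0%N, 0, 0, 1; rewrite !mul0r dhomog0 dhomog1 meval1 oner_neq0.
  split=> //; rewrite addr0 raddf0 mul0r big1 ?subr0 // => l _.
  by rewrite mxE mpolyC0 raddf0 mul0r.
(* The signs make 0 minus the combination with coordinates [v] equal to k0 e_0 + k1 e_1, which lies
   in the ideal; so [v] and the zero vector are both coordinates of 0. *)
pose v : 'rV[K]_m.+2 := \row_l (if l == ord0 then - k0 else if l == i1 then - k1 else 0).
have kv : k' = v.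
  apply: ku.
  rewrite (bigD1 ord0) // (bigD1 i1) //= big1 => [|l /andP[/negPf l0 /negPf l1]]; last first.
    by rewrite mxE l0 l1 mpolyC0 raddf0 mul0r.
  rewrite !mxE /= addr0 sub0r e0 e1 !mpolyCN !raddfN !mulNr opprD !opprK.
  rewrite (_ : _ + _ = (k0 *: (a0 * b1) + k1 *: (a1 * b0))%:F / (b0 * b1)%:F); last first.
    rewrite -!mul_mpolyC tofracD !tofracM.
    exact: add_scaled_fractions (nF _ nb0) (nF _ nb1).
  apply: (local_ideal_of_independent_gradients (d := (d0 + d1)%N) Qk ijk hF hG) => //.
  - by apply: dhomogD; apply: dhomogZ; [|rewrite addnC]; apply: dhomogM.
  - exact: dhomogM.
  - by rewrite mevalD !mevalZ.
  - by rewrite mevalM mulf_neq0.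
have := congr1 (fun w : 'rV_ _ => (w 0 ord0, w 0 i1)) (etrans (esym k_0) kv).
rewrite !mxE /= => -[/esym/eqP + /esym/eqP]; rewrite !oppr_eq0 => /eqP z0 /eqP z1.
by move: nk; rewrite z0 z1 eqxx.
Qed.

(* Comparing 1 and L / X_k, for a linear form L with L(Q) = 0, with the single basis element, and then
   differentiating at Q, shows that the gradient of L is a combination of those of F and G. *)
Lemma multiplicity1_transversal (K : fieldType) (Q : 'rV[K]_3)
    (F G : {mpoly K[3]}) (k i j : 'I_3) :
  Q 0 k != 0 -> uniq [:: k; i; j] -> F.@[Q 0] = 0 -> G.@[Q 0] = 0 ->
  intersection_multiplicity Q F G 1 ->
  F^`M(i).@[Q 0] * G^`M(j).@[Q 0] <> F^`M(j).@[Q 0] * G^`M(i).@[Q 0].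
Proof.
move=> Qk; rewrite /= !inE negb_or ![k == _]eq_sym => /and3P[/andP[ik jk] ij _] F0 G0.
case=> e _ hm tan.
have ex r : local_ring Q r -> exists s a b c,
    c.@[Q 0] != 0 /\ (r - (s%:MP)%:F * e ord0) * c%:F = (a * F + b * G)%:F.
  move=> /hm [s [/local_ideal_num [a [b [c h]]] _]]; exists (s 0 ord0), a, b, c.
  by move: h; rewrite big_ord1.
have [|s0 [a0 [b0 [c0 [nc0 h0]]]]] := ex 1.
  by exists 0%N, 1, 1; rewrite dhomog1 meval1 oner_neq0 divff // tofrac_eq0 oner_neq0.
(* Otherwise 1 would lie in the local ideal, and the denominator c0 would vanish at Q. *)
have ns0 : s0 != 0.
  apply: contraNneq nc0 => s00; move: h0; rewrite s00 mpolyC0 raddf0 mul0r subr0 mul1r.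
  move/eqP; rewrite tofrac_eq => /eqP ->.
  by rewrite mevalD !mevalM F0 G0 !mulr0 addr0.
have conormal l : l != k -> exists u v w, w != 0 /\ forall i', i' != k ->
    u * F^`M(i').@[Q 0] + v * G^`M(i').@[Q 0] = (l == i')%:R * w.
  move=> lk; pose X : {mpoly K[3]} := 'X_k; pose L := Q 0 k *: 'X_l - Q 0 l *: X.
  have nX : X.@[Q 0] != 0 by rewrite mevalXU.
  have nXF : X%:F != 0.
    by rewrite tofrac_eq0; apply: contraNneq nX => ->; rewrite meval0.
  have [|s [a [b [c [nc h]]]]] := ex (L%:F / X%:F).
    exists 1%N, L, X; split; rewrite ?dhomogX /= ?mdeg1 //.
    by apply: rpredB; apply: dhomogZ; rewrite dhomogX /= mdeg1.
  pose u := X * (s0%:MP * c0 * a - s%:MP * c * a0).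
  pose v := X * (s0%:MP * c0 * b - s%:MP * c * b0).
  have E : (s0 *: L - s *: X) * (c * c0) = u * F + v * G.
    apply/eqP; rewrite -tofrac_eq; apply/eqP.
    have -> : u * F + v * G = X * (s0%:MP * c0 * (a * F + b * G) - s%:MP * c * (a0 * F + b0 * G)).
      by rewrite /u /v; ring.
    rewrite -!mul_mpolyC !(tofracM, tofracB) -h -h0.
    by rewrite clear_fractions // /L tofracB.
  have s_0 : s = 0.
    have := congr1 (meval (Q 0)) E; rewrite mevalD !mevalM F0 G0 !mulr0 addr0.
    rewrite mevalB !mevalZ mevalB !mevalZ !mevalXU mulrC [Q 0 l * _]mulrC subrr mulr0 sub0r.
    move/eqP; rewrite !mulf_eq0 oppr_eq0 mulf_eq0 (negPf Qk) (negPf nc) (negPf nc0) /= orbF.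
    by move/eqP.
  exists u.@[Q 0], v.@[Q 0], (s0 * Q 0 k * (c.@[Q 0] * c0.@[Q 0])); split.
    by rewrite !mulf_neq0.
  move=> i' i'k; have := congr1 (fun p => p^`M(i').@[Q 0]) E.
  rewrite s_0 scale0r subr0 mderivD !mderivM !mevalD !mevalM F0 G0 !mulr0 !add0r => <-.
  rewrite mevalZ mevalB !mevalZ !mevalXU [Q 0 l * _]mulrC subrr mulr0 mul0r addr0.
  rewrite mderivZ mderivB !mderivZ !mderivX !mnm1E [k == _]eq_sym (negPf i'k).
  rewrite scale0r scaler0 subr0 !mevalZ -!mulrA [RHS]mulrCA; congr (_ * _).
  rewrite [RHS]mulrCA; congr (_ * _).
  case: eqP => [->|_]; last by rewrite !mul0r.
  by rewrite mnm_subUU mpolyX0 meval1 !mul1r.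
have [u [v [w [nw h]]]] := conormal i ik; have [u' [v' [w' [nw' h']]]] := conormal j jk.
(* The two relations form a diagonal 2 x 2 matrix with entries w, w'; it is the matrix of u, v, u',
   v' times that of the gradients, whose determinant is zero by tangency. *)
have /eqP[] : w * w' != 0 by rewrite mulf_neq0.
have := h i ik; have := h j jk; have := h' i ik; have := h' j jk.
rewrite !eqxx eq_sym (negPf ij) !mul0r !mul1r => <- e1 e2 <-.
set Fi := (F^`M(i)).@[_] in tan e1 *; set Fj := (F^`M(j)).@[_] in tan e2 *.
set Gi := (G^`M(i)).@[_] in tan e1 *; set Gj := (G^`M(j)).@[_] in tan e2 *.
transitivity ((u * v' - v * u') * (Fi * Gj - Fj * Gi)); last by rewrite tan subrr mulr0.
rewrite -[LHS]subr0 -(mulr0 (u * Fj + v * Gj)) -e1; ring.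
Qed.

(** * Cubics, conics and lines as coefficient vectors *)

Lemma ord3_cases (i : 'I_3) : [\/ i = 0, i = 1 | i = 2].
Proof.
by case: i => -[|[|[|//]]] h; [apply: Or31|apply: Or32|apply: Or33]; apply/val_inj.
Qed.

Lemma sum_ord3 (V : nmodType) (F : 'I_3 -> V) : \sum_i F i = F 0 + F 1 + F 2.
Proof.
rewrite !big_ord_recr big_ord0 /= add0r.
by do !congr (_ + _); congr F; apply/val_inj.
Qed.

Lemma sum_ord6 (V : nmodType) (F : 'I_6 -> V) :
  \sum_i F i = F 0 + F 1 + F 2 + F 3 + F 4 + F 5.
Proof.
rewrite !big_ord_recr big_ord0 /= add0r.
by do !congr (_ + _); congr F; apply/val_inj.
Qed.

Lemma sum_ord10 (V : nmodType) (F : 'I_10 -> V) :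
  \sum_i F i = F 0 + F 1 + F 2 + F 3 + F 4 + F 5 + F 6 + F 7 + F 8 + F 9.
Proof.
rewrite !big_ord_recr big_ord0 /= add0r.
by do !congr (_ + _); congr F; apply/val_inj.
Qed.

Definition dot (K : fieldType) (n : nat) (v : 'rV[K]_n) (f : 'cV[K]_n) : K := (v *m f) 0 0.

Definition comb (K : fieldType) (P1 P2 P3 : 'rV[K]_3) (x y z : K) : 'rV[K]_3 :=
  x *: P1 + y *: P2 + z *: P3.

(* The derivative at P of the cubic f in the direction R. *)
Definition polar (K : fieldType) (f : 'cV[K]_10) (P R : 'rV[K]_3) : K :=
  R 0 0 * dot (cubic_monomials_dx P) f + R 0 1 * dot (cubic_monomials_dy P) f
  + R 0 2 * dot (cubic_monomials_dz P) f.

Lemma dotE10 (K : fieldType) (s : seq K) (f : 'cV[K]_10) :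
  dot (row_of_seq 10 s) f = s`_0 * f 0 0 + s`_1 * f 1 0 + s`_2 * f 2 0 + s`_3 * f 3 0
   + s`_4 * f 4 0 + s`_5 * f 5 0 + s`_6 * f 6 0 + s`_7 * f 7 0 + s`_8 * f 8 0
   + s`_9 * f 9 0.
Proof. by rewrite /dot mxE sum_ord10 !mxE. Qed.

Lemma dotE6 (K : fieldType) (s : seq K) (f : 'cV[K]_6) :
  dot (row_of_seq 6 s) f = s`_0 * f 0 0 + s`_1 * f 1 0 + s`_2 * f 2 0 + s`_3 * f 3 0
   + s`_4 * f 4 0 + s`_5 * f 5 0.
Proof. by rewrite /dot mxE sum_ord6 !mxE. Qed.

(** The expansion of the cubic in the coordinates x, y, z, followed by its y- and z-derivatives; [m]
    is the coefficient of x y z. *)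
Lemma cubic_comb (K : fieldType) (f : 'cV[K]_10) (P1 P2 P3 : 'rV[K]_3) :
  exists m, forall x y z,
    dot (cubic_monomials (comb P1 P2 P3 x y z)) f =
    x ^+ 3 * dot (cubic_monomials P1) f + y ^+ 3 * dot (cubic_monomials P2) f
    + z ^+ 3 * dot (cubic_monomials P3) f
    + x ^+ 2 * y * polar f P1 P2 + x ^+ 2 * z * polar f P1 P3
    + y ^+ 2 * x * polar f P2 P1 + y ^+ 2 * z * polar f P2 P3
    + z ^+ 2 * x * polar f P3 P1 + z ^+ 2 * y * polar f P3 P2 + x * y * z * m
   /\ polar f (comb P1 P2 P3 x y z) P2 =
    3 * y ^+ 2 * dot (cubic_monomials P2) f + x ^+ 2 * polar f P1 P2
    + 2 * x * y * polar f P2 P1 + 2 * y * z * polar f P2 P3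
    + z ^+ 2 * polar f P3 P2 + x * z * m
   /\ polar f (comb P1 P2 P3 x y z) P3 =
    3 * z ^+ 2 * dot (cubic_monomials P3) f + x ^+ 2 * polar f P1 P3
    + 2 * x * z * polar f P3 P1 + 2 * y * z * polar f P3 P2
    + y ^+ 2 * polar f P2 P3 + x * y * m.
Proof.
(* The z-derivative at (1, 1, 0) is the sum of the two subtracted polars and of [m]; reading [m] off
   this way avoids any division. *)
exists (polar f (comb P1 P2 P3 1 1 0) P3 - polar f P1 P3 - polar f P2 P3) => x y z.
by split; [|split]; rewrite /polar !dotE10 /= !mxE; ring.
Qed.

(** Euler's identity in degree 3. *)
Lemma polar_self (K : fieldType) (f : 'cV[K]_10) (P : 'rV[K]_3) :
  polar f P P = 3 * dot (cubic_monomials P) f.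
Proof. by rewrite /polar !dotE10 /=; ring. Qed.

Definition det3 (K : fieldType) (A B C : 'rV[K]_3) : K :=
  A 0 0 * (B 0 1 * C 0 2 - B 0 2 * C 0 1)
  + A 0 1 * (B 0 2 * C 0 0 - B 0 0 * C 0 2)
  + A 0 2 * (B 0 0 * C 0 1 - B 0 1 * C 0 0).

Definition partial (K : fieldType) (f : 'cV[K]_10) (P : 'rV[K]_3) (i : 'I_3) : K :=
  dot (tnth [tuple cubic_monomials_dx P; cubic_monomials_dy P; cubic_monomials_dz P] i) f.

Definition jacobian (K : fieldType) (f g : 'cV[K]_10) (P R S : 'rV[K]_3) : K :=
  polar f P R * polar g P S - polar f P S * polar g P R.

Lemma polarE (K : fieldType) (f : 'cV[K]_10) (P R : 'rV[K]_3) :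
  polar f P R = R 0 0 * partial f P 0 + R 0 1 * partial f P 1 + R 0 2 * partial f P 2.
Proof. by []. Qed.

(** By Lagrange's identity the factor of p0 on the left is the product of r x s with b x c. As p is
    orthogonal to b and c, p0 (b x c) is the first entry of b x c times p. *)
Lemma cross_product_orthogonal (K : comNzRingType)
    (p0 p1 p2 b0 b1 b2 c0 c1 c2 r0 r1 r2 s0 s1 s2 : K) :
  p0 * b0 + p1 * b1 + p2 * b2 = 0 -> p0 * c0 + p1 * c1 + p2 * c2 = 0 ->
  ((r0 * b0 + r1 * b1 + r2 * b2) * (s0 * c0 + s1 * c1 + s2 * c2)
   - (s0 * b0 + s1 * b1 + s2 * b2) * (r0 * c0 + r1 * c1 + r2 * c2)) * p0 =
  (p0 * (r1 * s2 - r2 * s1) + p1 * (r2 * s0 - r0 * s2) + p2 * (r0 * s1 - r1 * s0))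
  * (b1 * c2 - b2 * c1).
Proof.
move=> pb pc; apply/eqP; rewrite -subr_eq0.
rewrite (_ : _ - _ =
  (r2 * s0 - r0 * s2) * (b2 * (p0 * c0 + p1 * c1 + p2 * c2) - c2 * (p0 * b0 + p1 * b1 + p2 * b2))
  + (r0 * s1 - r1 * s0) * (c1 * (p0 * b0 + p1 * b1 + p2 * b2)
                           - b1 * (p0 * c0 + p1 * c1 + p2 * c2))); last by ring.
by rewrite pb pc !mulr0 subrr !mulr0 addr0.
Qed.

(* By Euler the two gradients at P are orthogonal to P, so their cross product is a multiple of P. *)
Lemma jacobian_cross (K : fieldType) (k : 'I_3) :
  exists i j, perm_eq [:: k; i; j] (enum 'I_3) /\
  forall (f g : 'cV[K]_10) (P R S : 'rV[K]_3),
  dot (cubic_monomials P) f = 0 -> dot (cubic_monomials P) g = 0 ->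
  jacobian f g P R S * P 0 k = det3 P R S *
    (partial f P i * partial g P j - partial f P j * partial g P i).
Proof.
have pe (a b c : 'I_3) : uniq [:: a; b; c] -> perm_eq [:: a; b; c] (enum 'I_3).
  move=> u; apply: uniq_perm => //; first exact: enum_uniq.
  apply: (uniq_min_size u _ _).2 => [x _|]; first by rewrite mem_enum.
  by rewrite size_enum_ord.
have H f g (P : 'rV[K]_3) : dot (cubic_monomials P) f = 0 -> dot (cubic_monomials P) g = 0 ->
   P 0 0 * partial f P 0 + P 0 1 * partial f P 1 + P 0 2 * partial f P 2 = 0 /\
   P 0 0 * partial g P 0 + P 0 1 * partial g P 1 + P 0 2 * partial g P 2 = 0.
  by move=> f0 g0; rewrite -!polarE !polar_self f0 g0 mulr0.
case: (ord3_cases k) => ->.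
- exists 1, 2; split; first exact: pe.
  move=> f g P R S f0 g0; have [h1 h2] := H _ _ _ f0 g0.
  exact: cross_product_orthogonal.
- exists 2, 0; split; first exact: pe.
  move=> f g P R S f0 g0; have [h1 h2] := H _ _ _ f0 g0.
  rewrite /jacobian /det3 !polarE.
  have := @cross_product_orthogonal K (P 0 1) (P 0 2) (P 0 0) (partial f P 1) (partial f P 2)
    (partial f P 0) (partial g P 1) (partial g P 2) (partial g P 0)
    (R 0 1) (R 0 2) (R 0 0) (S 0 1) (S 0 2) (S 0 0).
  rewrite addrC addrA h1 addrC addrA h2 => /(_ erefl erefl) h.
  by apply: etrans (etrans _ h) _; ring.
- exists 0, 1; split; first exact: pe.
  move=> f g P R S f0 g0; have [h1 h2] := H _ _ _ f0 g0.
  rewrite /jacobian /det3 !polarE.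
  have := @cross_product_orthogonal K (P 0 2) (P 0 0) (P 0 1) (partial f P 2) (partial f P 0)
    (partial f P 1) (partial g P 2) (partial g P 0) (partial g P 1)
    (R 0 2) (R 0 0) (R 0 1) (S 0 2) (S 0 0) (S 0 1).
  rewrite -addrA addrC h1 -addrA addrC h2 => /(_ erefl erefl) h.
  by apply: etrans (etrans _ h) _; ring.
Qed.

Lemma dotDr (K : fieldType) (n : nat) (v : 'rV[K]_n) (f g : 'cV[K]_n) :
  dot v (f + g) = dot v f + dot v g.
Proof. by rewrite /dot mulmxDr mxE. Qed.

Lemma dotZr (K : fieldType) (n : nat) (v : 'rV[K]_n) (a : K) (f : 'cV[K]_n) :
  dot v (a *: f) = a * dot v f.
Proof. by rewrite /dot -scalemxAr mxE. Qed.

Lemma dotDl (K : fieldType) (n : nat) (v w : 'rV[K]_n) (f : 'cV[K]_n) :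
  dot (v + w) f = dot v f + dot w f.
Proof. by rewrite /dot mulmxDl mxE. Qed.

Lemma dotZl (K : fieldType) (n : nat) (v : 'rV[K]_n) (a : K) (f : 'cV[K]_n) :
  dot (a *: v) f = a * dot v f.
Proof. by rewrite /dot -scalemxAl mxE. Qed.

Lemma dot3E (K : fieldType) (v : 'rV[K]_3) (l : 'cV[K]_3) :
  dot v l = v 0 0 * l 0 0 + v 0 1 * l 1 0 + v 0 2 * l 2 0.
Proof. by rewrite /dot mxE sum_ord3. Qed.

Definition col_of_seq (K : fieldType) (n : nat) (s : seq K) : 'cV[K]_n := \col_(i < n) s`_i.

Lemma conic_of_lines (K : fieldType) (l m : 'cV[K]_3) :
  exists h : 'cV[K]_6, forall R : 'rV[K]_3,
    dot (quadratic_monomials R) h = dot R l * dot R m.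
Proof.
exists (col_of_seq 6 [:: l 0 0 * m 0 0; l 0 0 * m 1 0 + l 1 0 * m 0 0;
   l 0 0 * m 2 0 + l 2 0 * m 0 0; l 1 0 * m 1 0; l 1 0 * m 2 0 + l 2 0 * m 1 0; l 2 0 * m 2 0]) => R.
by rewrite dotE6 !dot3E !mxE /=; ring.
Qed.

Lemma cubic_of_conic_line (K : fieldType) (h : 'cV[K]_6) (l : 'cV[K]_3) :
  exists f : 'cV[K]_10, forall R : 'rV[K]_3,
    dot (cubic_monomials R) f = dot (quadratic_monomials R) h * dot R l.
Proof.
exists (col_of_seq 10 [:: h 0 0 * l 0 0; h 0 0 * l 1 0 + h 1 0 * l 0 0;
  h 0 0 * l 2 0 + h 2 0 * l 0 0; h 1 0 * l 1 0 + h 3 0 * l 0 0;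
  h 1 0 * l 2 0 + h 2 0 * l 1 0 + h 4 0 * l 0 0; h 2 0 * l 2 0 + h 5 0 * l 0 0;
  h 3 0 * l 1 0; h 3 0 * l 2 0 + h 4 0 * l 1 0; h 4 0 * l 2 0 + h 5 0 * l 1 0;
  h 5 0 * l 2 0]) => R.
by rewrite dotE6 dotE10 !dot3E !mxE /=; ring.
Qed.

(** The cross product, that is, the equation of the line BC; up to the factor [det3 A B C] it is the
    coordinate along A in the basis A, B, C. *)
Definition coordinate (K : fieldType) (B C : 'rV[K]_3) : 'cV[K]_3 :=
  col_of_seq 3 [:: B 0 1 * C 0 2 - B 0 2 * C 0 1; B 0 2 * C 0 0 - B 0 0 * C 0 2;
                   B 0 0 * C 0 1 - B 0 1 * C 0 0].

Lemma dot_coordinate (K : fieldType) (A B C : 'rV[K]_3) : dot A (coordinate B C) = det3 A B C.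
Proof. by rewrite dot3E !mxE. Qed.

Lemma combE (K : fieldType) (A B C R : 'rV[K]_3) :
  det3 A B C != 0 ->
  R = comb A B C (det3 R B C / det3 A B C) (det3 R C A / det3 A B C) (det3 R A B / det3 A B C).
Proof.
move=> D0; apply/rowP => i; rewrite !mxE; apply: (mulIf D0); apply/esym.
transitivity (det3 R B C * A 0 i + det3 R C A * B 0 i + det3 R A B * C 0 i); first by field.
case: (ord3_cases i) => ->.
all: by rewrite /det3; ring.
Qed.

Lemma det3_comb (K : fieldType) (A B C : 'rV[K]_3) x y z :
  [/\ det3 (comb A B C x y z) B C = x * det3 A B C,
      det3 (comb A B C x y z) C A = y * det3 A B C
    & det3 (comb A B C x y z) A B = z * det3 A B C].
Proof. by split; rewrite /det3 /comb !mxE; ring. Qed.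

Lemma conic_in_basis (K : fieldType) (A B C : 'rV[K]_3) (c1 c2 c3 c4 c5 c6 : K) :
  det3 A B C != 0 ->
  exists h : 'cV[K]_6, forall x y z,
    dot (quadratic_monomials (comb A B C x y z)) h =
    c1 * x ^+ 2 + c2 * x * y + c3 * x * z + c4 * y ^+ 2 + c5 * y * z + c6 * z ^+ 2.
Proof.
move=> D0; set D := det3 A B C in D0.
have cx x y z : dot (comb A B C x y z) (coordinate B C) = x * D.
  by rewrite dot_coordinate; case: (det3_comb A B C x y z).
have cy x y z : dot (comb A B C x y z) (coordinate C A) = y * D.
  by rewrite dot_coordinate; case: (det3_comb A B C x y z).
have cz x y z : dot (comb A B C x y z) (coordinate A B) = z * D.
  by rewrite dot_coordinate; case: (det3_comb A B C x y z).
have [h1 e1] := conic_of_lines (coordinate B C) (coordinate B C).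
have [h2 e2] := conic_of_lines (coordinate B C) (coordinate C A).
have [h3 e3] := conic_of_lines (coordinate B C) (coordinate A B).
have [h4 e4] := conic_of_lines (coordinate C A) (coordinate C A).
have [h5 e5] := conic_of_lines (coordinate C A) (coordinate A B).
have [h6 e6] := conic_of_lines (coordinate A B) (coordinate A B).
exists (D ^- 2 *: (c1 *: h1 + c2 *: h2 + c3 *: h3 + c4 *: h4 + c5 *: h5 + c6 *: h6)) => x y z.
rewrite dotZr !dotDr !dotZr e1 e2 e3 e4 e5 e6 !cx !cy !cz.
by field.
Qed.

(** With q the quadratic monomials, h(A) q(B) - h(B) q(A) is orthogonal to h, and so are the
    monomials of the five points. Six vectors orthogonal to a nonzero h have determinant zero, and
    the determinant is linear in its first row. *)
Lemma conic_values_ratio (K : fieldType) (A B Q2 Q3 Q4 Q5 Q6 : 'rV[K]_3) (h : 'cV[K]_6) :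
  (forall Q, Q \in [:: Q2; Q3; Q4; Q5; Q6] -> dot (quadratic_monomials Q) h = 0) ->
  dot (quadratic_monomials A) h * Cdet B Q2 Q3 Q4 Q5 Q6 =
  dot (quadratic_monomials B) h * Cdet A Q2 Q3 Q4 Q5 Q6.
Proof.
move=> hQ; have [->|h0] := eqVneq h 0; first by rewrite /dot !mulmx0 !mxE !mul0r.
pose M R : 'M[K]_6 := \matrix_(i < 6) quadratic_monomials (tnth [tuple R; Q2; Q3; Q4; Q5; Q6] i).
pose a := dot (quadratic_monomials A) h; pose b := dot (quadratic_monomials B) h.
pose v := a *: quadratic_monomials B - b *: quadratic_monomials A.
pose N : 'M[K]_6 := \matrix_(i < 6) (if i == 0 then v else row i (M A)).
have N0 : N *m h = 0.
  apply/row_matrixP => i; rewrite row_mul rowK row0; apply/rowP => j.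
  rewrite (ord1 j) [RHS]mxE.
  case: eqP => [_|i0].
    rewrite -[LHS]/(dot v h) /v dotDl -scaleNr !dotZl -/a -/b; ring.
  rewrite rowK -[LHS]/(dot _ h) hQ //.
  case: i i0 => -[|i] lt i0; first by case: i0; apply/val_inj.
  by rewrite (tnth_nth 0) /= mem_nth.
have dN : \det N = 0.
  apply/eqP; apply: contraNT h0 => uN; apply/eqP.
  have uN' : N \in unitmx by rewrite unitmxE unitfE.
  by rewrite -(mulKmx uN' h) N0 mulmx0.
have : \det N = a * \det (M B) + (- b) * \det (M A).
  have r' R : row' 0 (M R) = row' 0 N.
    apply/row_matrixP => i; rewrite !row'Esub; apply/rowP => j; rewrite !mxE /=.
    by case: i => -[|[|[|[|[|//]]]]] lt //=; rewrite !(tnth_nth 0).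
  apply: (determinant_multilinear (i0 := 0)); rewrite ?r' //.
  by rewrite !rowK eqxx !(tnth_nth 0) /= /v scaleNr.
by rewrite dN /Cdet mulNr => /esym/eqP; rewrite subr_eq0 => /eqP.
Qed.

(** The pure cubes are absent because the cubic passes through the three base points. The letters a,
    b, c name the base point and the digits the direction of the polar: a2 is the polar at the first
    point towards the second. *)
Definition cubic_in_basis (K : fieldType) (a2 a3 b1 b3 c1 c2 m x y z : K) : K :=
  x ^+ 2 * y * a2 + x ^+ 2 * z * a3 + y ^+ 2 * x * b1 + y ^+ 2 * z * b3
  + z ^+ 2 * x * c1 + z ^+ 2 * y * c2 + x * y * z * m.

(* The conics y (x Z - z X) and z (x Y - y X) vanish at the three base points and at (X, Y, Z);
   cofactor1 and cofactor2 are their coefficients in X Y Z times a cubic through these points. *)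
Definition cofactor1 (K : fieldType) (a2 b1 c1 c2 X Y Z x y z : K) : K :=
  X * Y * (a2 * x + b1 * y) - (c1 * X + c2 * Y) * Z * z.
Definition cofactor2 (K : fieldType) (a3 b1 b3 c1 X Y Z x y z : K) : K :=
  X * Z * (a3 * x + c1 * z) - (b1 * X + b3 * Z) * Y * y.

(** The left side is identically X Y Z F(x, y, z) - x y z F(X, Y, Z), F being the cubic; the term in
    [m] cancels there, which is why the cofactors do not contain it. *)
Lemma cofactor_decomp (K : fieldType) (a2 a3 b1 b3 c1 c2 m X Y Z x y z : K) :
  cubic_in_basis a2 a3 b1 b3 c1 c2 m X Y Z = 0 ->
  cubic_in_basis a2 a3 b1 b3 c1 c2 m x y z = 0 ->
  y * (x * Z - z * X) * cofactor1 a2 b1 c1 c2 X Y Z x y z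
  + z * (x * Y - y * X) * cofactor2 a3 b1 b3 c1 X Y Z x y z = 0.
Proof.
move=> FP Fp; have <- : X * Y * Z * cubic_in_basis a2 a3 b1 b3 c1 c2 m x y z
   - x * y * z * cubic_in_basis a2 a3 b1 b3 c1 c2 m X Y Z = 0 by rewrite FP Fp !mulr0 subrr.
by rewrite /cubic_in_basis /cofactor1 /cofactor2; ring.
Qed.

Lemma det2_kernel (K : fieldType) (A B l l' m m' : K) :
  (A != 0) || (B != 0) -> A * l + B * l' = 0 -> A * m + B * m' = 0 -> l * m' - l' * m = 0.
Proof.
move=> AB e e'; have h1 : A * (l * m' - l' * m) = 0.
  rewrite (_ : _ * _ = (A * l + B * l') * m' - l' * (A * m + B * m')); last by ring.
  by rewrite e e' mul0r mulr0 subrr.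
have h2 : B * (l * m' - l' * m) = 0.
  rewrite (_ : _ * _ = l * (A * m + B * m') - (A * l + B * l') * m); last by ring.
  by rewrite e e' mul0r mulr0 subrr.
case/orP: AB => nz; apply: (mulfI nz); by rewrite mulr0.
Qed.

Lemma comb_rot (K : fieldType) (A B C : 'rV[K]_3) (x y z : K) :
  comb A B C x y z = comb B C A y z x.
Proof. by rewrite /comb -addrA addrC. Qed.

Lemma det3_rot (K : fieldType) (A B C : 'rV[K]_3) : det3 B C A = det3 A B C.
Proof. by rewrite /det3; ring. Qed.

(** * Coefficient vectors as homogeneous polynomials *)

Definition form_of (K : fieldType) (k n : nat) (e : n.-tuple 'X_{1..k}) (f : 'cV[K]_n) :
  {mpoly K[k]} := \sum_(j < n) f j 0 *: 'X_[tnth e j].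

Lemma form_of_homog (K : fieldType) (k n d : nat) (e : n.-tuple 'X_{1..k}) (f : 'cV[K]_n) :
  all (fun m => mdeg m == d) e -> form_of e f \is d.-homog.
Proof.
move=> /all_tnthP he; apply: rpred_sum => j _; apply: dhomogZ.
by rewrite dhomogX /= he.
Qed.

Lemma form_of_coef (K : fieldType) (k n : nat) (e : n.-tuple 'X_{1..k}) (f : 'cV[K]_n) j :
  uniq e -> (form_of e f)@_(tnth e j) = f j 0.
Proof.
move=> /tuple_uniqP ue; rewrite raddf_sum (bigD1 j) //= big1 => [|i ij].
  by rewrite addr0 mcoeffZ mcoeffX eqxx mulr1.
by rewrite mcoeffZ mcoeffX (inj_eq ue) (negPf ij) mulr0.
Qed.

Lemma form_of_meval (K : fieldType) (k n : nat) (e : n.-tuple 'X_{1..k}) (f : 'cV[K]_n) v :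
  (form_of e f).@[v] = \sum_(j < n) f j 0 * \prod_i v i ^+ tnth e j i.
Proof.
rewrite /form_of (raddf_sum (meval v)) /=; apply: eq_bigr => j _.
by rewrite mevalZ mevalX.
Qed.

(** Where the subtraction of exponents truncates, the factor [(tnth e j i)%:R] is zero. *)
Lemma form_of_mderiv (K : fieldType) (k n : nat) (e : n.-tuple 'X_{1..k}) (f : 'cV[K]_n) v i :
  ((form_of e f)^`M(i)).@[v] =
  \sum_(j < n) f j 0 * ((tnth e j i)%:R * \prod_l v l ^+ (tnth e j l - (i == l))).
Proof.
rewrite /form_of (linear_sum (mderiv i)) (raddf_sum (meval v)) /=; apply: eq_bigr => j _.
rewrite mderivZ mderivX !mevalZ mevalX; congr (_ * (_ * _)); apply: eq_bigr => l _.
by rewrite mnmBE mnm1E.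
Qed.

Lemma form_of_inj (K : fieldType) (k n : nat) (e : n.-tuple 'X_{1..k}) :
  uniq e -> injective (@form_of K k n e).
Proof.
move=> ue f g /(congr1 (fun p => \col_j p@_(tnth e j))) h; apply/matrixP => i j.
by rewrite (ord1 j); move/matrixP/(_ i 0): h; rewrite !mxE !form_of_coef.
Qed.

Lemma form_of_curve (K : fieldType) (n d : nat) (e : n.-tuple 'X_{1..3}) (f : 'cV[K]_n) :
  uniq e -> all (fun m => mdeg m == d) e -> f != 0 -> curve d (form_of e f).
Proof.
move=> ue he f0; split; last exact: form_of_homog.
apply: contraNneq f0 => z; apply/eqP/(form_of_inj ue).
by rewrite z /form_of big1 // => j _; rewrite mxE scale0r.
Qed.

Definition mon3 (a b c : nat) : 'X_{1..3} := [multinom nth 0%N [:: a; b; c] i | i < 3].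

Lemma eq_mon3 a b c a' b' c' : (mon3 a b c == mon3 a' b' c') = [&& a == a', b == b' & c == c'].
Proof.
apply/eqP/and3P => [/mnmP h|[/eqP-> /eqP-> /eqP->] //].
by have := h 0; have := h 1; have := h 2; rewrite !mnmE /= => -> -> ->.
Qed.

Lemma mdeg_mon3 a b c : mdeg (mon3 a b c) = (a + b + c)%N.
Proof. by rewrite mdegE !big_ord_recr big_ord0 /= !mnmE /= add0n. Qed.

(** Here and below the order of the exponents is that of the coordinates, of [quadratic_monomials]
    and of [cubic_monomials], so that evaluating [form_of] is a [dot]. *)
Definition line_exponents : 3.-tuple 'X_{1..3} :=
  [tuple mon3 1 0 0; mon3 0 1 0; mon3 0 0 1].
Definition conic_exponents : 6.-tuple 'X_{1..3} :=
  [tuple mon3 2 0 0; mon3 1 1 0; mon3 1 0 1; mon3 0 2 0; mon3 0 1 1; mon3 0 0 2].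
Definition cubic_exponents : 10.-tuple 'X_{1..3} :=
  [tuple mon3 3 0 0; mon3 2 1 0; mon3 2 0 1; mon3 1 2 0; mon3 1 1 1; mon3 1 0 2;
         mon3 0 3 0; mon3 0 2 1; mon3 0 1 2; mon3 0 0 3].

Lemma line_exponents_uniq : uniq line_exponents.
Proof. by rewrite /= !inE !eq_mon3. Qed.
Lemma conic_exponents_uniq : uniq conic_exponents.
Proof. by rewrite /= !inE !eq_mon3. Qed.
Lemma cubic_exponents_uniq : uniq cubic_exponents.
Proof. by rewrite /= !inE !eq_mon3. Qed.

Lemma prod_mon3 (K : fieldType) (v : 'I_3 -> K) (F : 'I_3 -> nat) :
  \prod_i v i ^+ F i = v 0 ^+ F 0 * v 1 ^+ F 1 * v 2 ^+ F 2.
Proof.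
rewrite !big_ord_recr big_ord0 /= mul1r.
by congr (_ * _ * _); congr (v _ ^+ F _); apply/val_inj.
Qed.

Lemma line_meval (K : fieldType) (f : 'cV[K]_3) (P : 'rV[K]_3) :
  (form_of line_exponents f).@[P 0] = dot P f.
Proof.
rewrite form_of_meval dot3E sum_ord3 !(tnth_nth 0%MM) /= !prod_mon3 !mnmE /=.
by rewrite !expr0 !expr1 !mulr1 !mul1r; do !congr (_ + _); rewrite mulrC.
Qed.

Lemma conic_meval (K : fieldType) (f : 'cV[K]_6) (P : 'rV[K]_3) :
  (form_of conic_exponents f).@[P 0] = dot (quadratic_monomials P) f.
Proof.
rewrite form_of_meval dotE6 sum_ord6 !(tnth_nth 0%MM) /= !prod_mon3 !mnmE /=.
by ring.
Qed.

Lemma cubic_meval (K : fieldType) (f : 'cV[K]_10) (P : 'rV[K]_3) :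
  (form_of cubic_exponents f).@[P 0] = dot (cubic_monomials P) f.
Proof.
rewrite form_of_meval dotE10 sum_ord10 !(tnth_nth 0%MM) /= !prod_mon3 !mnmE /=.
by ring.
Qed.

Lemma cubic_mderiv (K : fieldType) (f : 'cV[K]_10) (P : 'rV[K]_3) i :
  ((form_of cubic_exponents f)^`M(i)).@[P 0] = partial f P i.
Proof.
rewrite form_of_mderiv /partial sum_ord10 !(tnth_nth 0%MM) /= !prod_mon3 !mnmE /=.
case: (ord3_cases i) => ->.
all: by rewrite (tnth_nth 0) /= dotE10 /=; ring.
Qed.

Lemma cubic_through_form (K : fieldType) (P : 8.-tuple 'rV[K]_3) (e : 'cV[K]_10) :
  e != 0 -> (forall j, dot (cubic_monomials (tnth P j)) e = 0) ->
  cubic_through P (form_of cubic_exponents e).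
Proof.
move=> e0 eP; split=> [|j]; last by rewrite /passes cubic_meval.
by apply: form_of_curve; rewrite ?cubic_exponents_uniq //= !mdeg_mon3.
Qed.

Lemma singular_kernel (K : fieldType) (n : nat) (M : 'M[K]_n) :
  \det M = 0 -> exists2 f : 'cV[K]_n, f != 0 & forall i, dot (row i M) f = 0.
Proof.
move=> d0; have /eqP : \det M^T = 0 by rewrite det_tr.
move=> /det0P[v v0 vM]; exists v^T => [|i].
  by apply: contraNneq v0 => /(congr1 trmx); rewrite trmxK trmx0 => ->.
rewrite /dot -row_mul -[M]trmxK -trmx_mul vM trmx0 !mxE //.
Qed.

Lemma det_mx3 (K : fieldType) (M : 'M[K]_3) : \det M = det3 (row 0 M) (row 1 M) (row 2 M).
Proof.
have det_mx2 (N : 'M[K]_2) : \det N = N 0 0 * N 1 1 - N 0 1 * N 1 0.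
  rewrite (expand_det_row _ 0) big_ord_recl big_ord1 /cofactor !det_mx11 !mxE /=.
  rewrite expr0 mul1r expr1 mulN1r mulrN.
  by congr (N _ _ * N _ _ - N _ _ * N _ _); apply/val_inj.
rewrite (expand_det_row _ 0) sum_ord3 /cofactor !det_mx2 !mxE /=.
rewrite expr0 expr1 sqrrN expr1n /det3 !mxE.
have -> : lift 0 0 = 1 :> 'I_3 by apply/val_inj.
have -> : lift 0 1 = 2 :> 'I_3 by apply/val_inj.
have -> : lift 1 0 = 0 :> 'I_3 by apply/val_inj.
have -> : lift 1 1 = 2 :> 'I_3 by apply/val_inj.
have -> : lift 2 0 = 0 :> 'I_3 by apply/val_inj.
have -> : lift 2 1 = 1 :> 'I_3 by apply/val_inj.
by ring.
Qed.

(** A kernel vector of the singular matrix would be the coefficient vector of a forbidden conic. *)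
Lemma six_not_on_conic (K : fieldType) (P : 8.-tuple 'rV[K]_3) (i1 i2 i3 i4 i5 i6 : 'I_8) :
  general_position P -> uniq [:: i1; i2; i3; i4; i5; i6] ->
  Cdet (tnth P i1) (tnth P i2) (tnth P i3) (tnth P i4) (tnth P i5) (tnth P i6) != 0.
Proof.
case=> _ _ gp u; apply/negP => /eqP /singular_kernel [f f0 fk].
apply: (gp [set i in [:: i1; i2; i3; i4; i5; i6]]).
  by rewrite cardsE (card_uniqP u).
exists (form_of conic_exponents f).
  by apply: form_of_curve; rewrite ?conic_exponents_uniq //= !mdeg_mon3.
move=> i; rewrite inE /passes conic_meval => /(nthP 0)[j lt <-].
have := fk (Ordinal lt); rewrite rowK (tnth_nth 0) /=.
by move: j lt => [|[|[|[|[|[|//]]]]]].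
Qed.

Lemma three_not_on_line (K : fieldType) (P : 8.-tuple 'rV[K]_3) (i1 i2 i3 : 'I_8) :
  general_position P -> uniq [:: i1; i2; i3] ->
  det3 (tnth P i1) (tnth P i2) (tnth P i3) != 0.
Proof.
case=> _ gp _ u; apply/negP => /eqP d0.
have /singular_kernel [f f0 fk] :
    \det (\matrix_(i < 3) tnth [tuple tnth P i1; tnth P i2; tnth P i3] i) = 0.
  by rewrite det_mx3 !rowK; exact: d0.
apply: (gp [set i in [:: i1; i2; i3]]).
  by rewrite cardsE (card_uniqP u).
exists (form_of line_exponents f).
  by apply: form_of_curve; rewrite ?line_exponents_uniq //= !mdeg_mon3.
move=> i; rewrite inE /passes line_meval => /(nthP 0)[j lt <-].
have := fk (Ordinal lt); rewrite rowK (tnth_nth 0) /=.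
by move: j lt => [|[|[|//]]].
Qed.

Lemma conic_through_five (K : fieldType) (Q2 Q3 Q4 Q5 Q6 : 'rV[K]_3) :
  exists h : 'cV[K]_6, forall R, dot (quadratic_monomials R) h = Cdet R Q2 Q3 Q4 Q5 Q6.
Proof.
pose M R : 'M[K]_6 := \matrix_(i < 6) quadratic_monomials (tnth [tuple R; Q2; Q3; Q4; Q5; Q6] i).
(* The cofactors along the first row do not involve that row, so 0 is a mere placeholder for R. *)
exists (\col_j cofactor (M 0) 0 j) => R.
rewrite /Cdet -/(M R) (expand_det_row _ 0) /dot mxE; apply: eq_bigr => j _.
rewrite !mxE (tnth_nth 0) /= [RHS]mulrC [LHS]mulrC; congr (_ * _).
rewrite /cofactor; congr (_ * \det _); apply/matrixP => a b; rewrite !mxE.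
by case: a => -[|[|[|[|[|//]]]]] lt /=; rewrite !(tnth_nth 0).
Qed.

Lemma Cdet_repeat (K : fieldType) (Q2 Q3 Q4 Q5 Q6 : 'rV[K]_3) R :
  R \in [:: Q2; Q3; Q4; Q5; Q6] -> Cdet R Q2 Q3 Q4 Q5 Q6 = 0.
Proof.
move=> /(nthP 0)[j lt jR]; have lt' : (j.+1 < 6)%N by [].
apply: (determinant_alternate (i1 := 0) (i2 := Ordinal lt')) => // k.
by rewrite !mxE !(tnth_nth 0) /= jR.
Qed.

(** In the rank normal form of V, the last k rows of the invertible [row_ebase V] supply the missing
    rows. *)
Lemma row_free_complete (K : fieldType) (m k : nat) (V : 'M[K]_(m, m + k)) :
  row_free V -> exists W : 'M[K]_(k, m + k), col_mx V W \in unitmx.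
Proof.
move=> /eqP rV; have := mulmx_ebase V; rewrite rV => e.
exists (row_mx 0 1%:M *m row_ebase V).
rewrite -{1}e -mulmxA.
have -> : pid_mx m = row_mx 1%:M 0 :> 'M[K]_(m, m + k).
  by rewrite -[RHS]pid_mx_row //.
rewrite mulmxA mul_mx_row mulmx1 mulmx0 -mul_col_mx unitmx_mul row_ebase_unit andbT.
by rewrite -[col_mx _ _]/(block_mx _ _ _ _) unitmxE det_ublock det1 mulr1 -unitmxE col_ebase_unit.
Qed.

(** * Eight points in general position *)

(** The cubic is a conic through five of the other points together with the line through the
    remaining two; general position keeps both off the i-th point. The transposition [s] renames
    that point to index 0. *)
Lemma cubics_separate_points (K : fieldType) (P : 8.-tuple 'rV[K]_3) (i : 'I_8) :
  general_position P -> exists f : 'cV[K]_10, forall j,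
    (dot (cubic_monomials (tnth P j)) f != 0) = (j == i).
Proof.
move=> gp; pose s : {perm 'I_8} := tperm 0 i; pose p k := tnth P (s k).
have us (e : seq 'I_8) : uniq e -> uniq (map s e) by rewrite (map_inj_uniq (@perm_inj _ s)).
have [h eh] := conic_through_five (p 1) (p 2) (p 3) (p 4) (p 5).
have [f ef] := cubic_of_conic_line h (coordinate (p 6) (p 7)).
exists f => j; rewrite ef eh dot_coordinate -[j](permKV s).
set k := (s^-1)%g j; rewrite -[X in _ = (_ == X)](tpermL 0 i) -/s (inj_eq perm_inj) -/(p k).
have [->|k0] := eqVneq k 0.
  rewrite mulf_neq0 //.
    by apply: (six_not_on_conic gp (i1 := s 0)); rewrite -/(map s [:: 0; 1; 2; 3; 4; 5]) us.
  by apply: (three_not_on_line gp (i1 := s 0)); rewrite -/(map s [:: 0; 6; 7]) us.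
apply/negbTE; rewrite negbK mulf_eq0.
have [|kn] := boolP (k \in [:: 1; 2; 3; 4; 5]).
  move=> kin; rewrite Cdet_repeat ?eqxx //.
  by rewrite -/(map p [:: 1; 2; 3; 4; 5]) map_f.
have : k \in [:: 6; 7] by case: k k0 kn => -[|[|[|[|[|[|[|[|//]]]]]]]].
by rewrite !inE => /orP[] /eqP ->; rewrite /det3; apply/orP; right; apply/eqP; ring.
Qed.

Definition cubic_rows (K : fieldType) (P : 8.-tuple 'rV[K]_3) : 'M[K]_(8, 8 + 2) :=
  \matrix_(i < 8) cubic_monomials (tnth P i).

(** Pairing a linear relation between the rows with a cubic that misses only the i-th point isolates
    its i-th coefficient. *)
Lemma cubic_rows_free (K : fieldType) (P : 8.-tuple 'rV[K]_3) :
  general_position P -> row_free (cubic_rows P).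
Proof.
move=> gp; rewrite -kermx_eq0; apply/eqP/row_matrixP => l; rewrite row0.
set r := row l _; have rV : r *m cubic_rows P = 0 by rewrite -row_mul mulmx_ker row0.
apply/rowP => i; rewrite [RHS]mxE; have [f hf] := cubics_separate_points i gp.
have : (r *m (cubic_rows P *m f)) 0 0 = 0 by rewrite mulmxA rV mul0mx mxE.
have e j : (cubic_rows P *m f) j 0 = dot (cubic_monomials (tnth P j)) f.
  by rewrite /dot -(rowK (fun j => cubic_monomials (tnth P j))) -row_mul [RHS]mxE.
rewrite mxE (bigD1 i) //= big1 => [|j ji].
  rewrite addr0 e => /eqP; rewrite mulf_eq0; have := hf i.
  by rewrite eqxx => /negPf ->; rewrite orbF => /eqP.
by have := hf j; rewrite e (negPf ji) => /negbFE/eqP->; rewrite mulr0.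
Qed.

(** The matrix of [Ddet] with its three gradient rows replaced by evaluation at P1 and two free
    rows; keeping the first seven rows in place makes the comparison block triangular. *)
Definition evaluation_mx (K : fieldType) (P1 P2 P3 P4 P5 P6 P7 P8 : 'rV[K]_3)
    (w1 w2 : 'rV[K]_10) : 'M[K]_10 :=
  \matrix_(i < 10)
    tnth [tuple cubic_monomials P2; cubic_monomials P3; cubic_monomials P4;
                cubic_monomials P5; cubic_monomials P6; cubic_monomials P7;
                cubic_monomials P8; cubic_monomials P1; w1; w2] i.

(** Rotating the three points permutes rows 0, 1 and 7 by a 3-cycle, which is even. *)
Lemma det_evaluation_mx_rot (K : fieldType) (P1 P2 P3 P4 P5 P6 P7 P8 : 'rV[K]_3)
    (w1 w2 : 'rV[K]_10) :
  \det (evaluation_mx P2 P3 P1 P4 P5 P6 P7 P8 w1 w2) =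
  \det (evaluation_mx P1 P2 P3 P4 P5 P6 P7 P8 w1 w2).
Proof.
have -> : evaluation_mx P2 P3 P1 P4 P5 P6 P7 P8 w1 w2 =
    xrow 0 1 (xrow 0 7 (evaluation_mx P1 P2 P3 P4 P5 P6 P7 P8 w1 w2)).
  apply/matrixP => i j; rewrite !mxE !permE !(tnth_nth 0) /=.
  by case: i => -[|[|[|[|[|[|[|[|[|[|//]]]]]]]]]].
rewrite /xrow !row_permE !det_mulmx !det_perm !odd_tperm /=.
by rewrite !expr1 !mulN1r opprK.
Qed.

Lemma evaluation_mx_unit (K : fieldType) (P1 P2 P3 P4 P5 P6 P7 P8 : 'rV[K]_3) :
  general_position [tuple P1; P2; P3; P4; P5; P6; P7; P8] ->
  exists w1 w2, evaluation_mx P1 P2 P3 P4 P5 P6 P7 P8 w1 w2 \in unitmx.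
Proof.
set P := [tuple _; _; _; _; _; _; _; _] => gp.
have [W uW] := row_free_complete (cubic_rows_free gp).
exists (row 0 W), (row 1 W).
pose s (i : 'I_10) : 'I_10 := tnth [tuple 1; 2; 3; 4; 5; 6; 7; 0; 8; 9] i.
have si : injective s by apply/tuple_uniqP.
have -> : evaluation_mx P1 P2 P3 P4 P5 P6 P7 P8 (row 0 W) (row 1 W) =
    row_perm (perm si) (col_mx (cubic_rows P) W).
  apply/row_matrixP => i; rewrite rowK row_permEsub row_rowsub permE /s !(tnth_nth 0).
  have eU (k : 'I_8) (l : 'I_10) : val k = val l ->
      cubic_monomials (tnth P k) = row l (col_mx (cubic_rows P) W).
    move=> kl; have -> : l = lshift 2 k by apply/val_inj.
    exact: etrans (esym (rowK _ k)) (esym (rowKu k (cubic_rows P) W)).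
  have eD (k : 'I_2) (l : 'I_10) : (8 + val k)%N = val l ->
      row k W = row l (col_mx (cubic_rows P) W).
    move=> kl; have -> : l = rshift 8 k by apply/val_inj.
    exact: esym (rowKd k (cubic_rows P) W).
  case: i => -[|[|[|[|[|[|[|[|[|[|//]]]]]]]]]] lt /=.
  - exact: (eU 1).
  - exact: (eU 2).
  - exact: (eU 3).
  - exact: (eU 4).
  - exact: (eU 5).
  - exact: (eU 6).
  - exact: (eU 7).
  - exact: (eU 0).
  - exact: (eD 0).
  - exact: (eD 1).
by rewrite row_permE unitmx_mul unitmx_perm.
Qed.

(* Multiplying by the inverse of evaluation_mx reduces the determinant to that of the gradients at
   P1 of the cubics u, f, g dual to the last three rows.  By Euler, P1 is orthogonal to the gradients
   of f and g, and its product with that of u is 3 u(P1) = 3. *)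
Lemma Ddet_jacobian (K : fieldType) (P1 P2 P3 P4 P5 P6 P7 P8 R S : 'rV[K]_3)
    (w1 w2 : 'rV[K]_10) (f g : 'cV[K]_10) :
  let W := evaluation_mx P1 P2 P3 P4 P5 P6 P7 P8 w1 w2 in
  W \in unitmx -> W *m f = delta_mx 8 0 -> W *m g = delta_mx 9 0 ->
  Ddet P1 P2 P3 P4 P5 P6 P7 P8 * det3 P1 R S = 3 * jacobian f g P1 R S * \det W.
Proof.
move=> W uW Wf Wg; rewrite /Ddet; set M := \matrix_(i < 10) _.
pose u := invmx W *m delta_mx 7 0 : 'cV[K]_10.
have Wu : W *m u = delta_mx 7 0 by rewrite mulKVmx.
have ev k (F : 'cV[K]_10) : W *m F = delta_mx k 0 -> dot (cubic_monomials P1) F = (7 == k)%:R.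
  move=> WF; transitivity ((W *m F) 7 0); last by rewrite WF mxE andbT.
  by rewrite [RHS]mxE /dot [LHS]mxE; apply: eq_bigr => j _; rewrite [W _ _]mxE.
have colU k (F : 'cV[K]_10) : W *m F = delta_mx k 0 -> col k (invmx W) = F.
  by move=> WF; rewrite -[F](mulKmx uW) WF -colE.
(* M and W share their first seven rows, so the top of L is that of the identity, and only the lower
   right 3 x 3 block contributes to its determinant. *)
pose L : 'M[K]_(7 + 3) := M *m invmx W.
have -> : \det M = \det L * \det W by rewrite -det_mulmx mulmxKV.
have rowML (i : 'I_7) : row (lshift 3 i) L = delta_mx 0 (lshift 3 i).
  have rowMW : row (lshift 3 i) M = row (lshift 3 i) W.
    apply: etrans (rowK _ _) (esym (etrans (rowK _ _) _)); rewrite !(tnth_nth 0) /=.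
    by case: i => -[|[|[|[|[|[|[|//]]]]]]].
  apply: etrans (row_mul _ M (invmx W)) _; rewrite rowMW.
  by apply: etrans (esym (row_mul _ W (invmx W))) _; rewrite mulmxV // row1.
have -> : \det L = \det (drsubmx L).
  rewrite -[in LHS](submxK L).
  have -> : ursubmx L = 0.
    apply/matrixP => i j; rewrite !mxE.
    by move/rowP/(_ (rshift 7 j)): (rowML i); rewrite !mxE eq_rlshift.
  have -> : ulsubmx L = 1%:M.
    apply/matrixP => i j; rewrite !mxE.
    by move/rowP/(_ (lshift 3 j)): (rowML i); rewrite !mxE eq_lshift eq_sym.
  by rewrite det_lblock det1 mul1r.
have dE (i j : 'I_3) (k : 'I_10) (F : 'cV[K]_10) : val k = (7 + val j)%N ->
    W *m F = delta_mx k 0 -> drsubmx L i j = partial F P1 i.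
  move=> kj /colU <-; rewrite !mxE /partial /dot mxE; apply: eq_bigr => l _.
  rewrite !mxE; congr (_ * invmx W l _); last by apply/val_inj.
  by case: i => -[|[|[|//]]] lt; rewrite !(tnth_nth 0).
have rE (N : 'M[K]_3) i j : row i N 0 j = N i j by rewrite mxE.
rewrite det_mx3 /det3 !rE.
rewrite !(dE _ 0 7 u) // !(dE _ 1 8 f) // !(dE _ 2 9 g) //.
have := polar_self u P1; have := polar_self f P1; have := polar_self g P1.
rewrite (ev _ _ Wu) (ev _ _ Wf) (ev _ _ Wg) /= !mulr0 mulr1 => eg ef <-.
(* The gradients of u, f, g times the matrix of P1, R, S give a 3 x 3 matrix of polars; its
   determinant is expanded along the direction P1. *)
transitivity (\det W * (polar u P1 P1 * jacobian f g P1 R S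
  - polar f P1 P1 * jacobian u g P1 R S + polar g P1 P1 * jacobian u f P1 R S)).
  by rewrite /jacobian !polarE; ring.
by rewrite ef eg !mul0r subr0 addr0; ring.
Qed.

(** * The ninth point *)

Lemma same_point_sym (K : fieldType) (P Q : 'rV[K]_3) : same_point P Q = same_point Q P.
Proof. by rewrite /same_point andbC. Qed.

Lemma same_point_trans (K : fieldType) (P Q R : 'rV[K]_3) :
  same_point P Q -> same_point Q R -> same_point P R.
Proof. by move=> /eqmxP PQ /eqmxP QR; apply/eqmxP; apply: eqmx_trans PQ QR. Qed.

Lemma same_point_scale (K : fieldType) (P Q : 'rV[K]_3) (a : K) :
  a != 0 -> same_point P (a *: Q) = same_point P Q.
Proof. by move=> a0; rewrite /same_point !(eqmx_scale _ a0). Qed.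

Lemma same_point_refl (K : fieldType) (P : 'rV[K]_3) : same_point P P.
Proof. exact/eqmxP/eqmx_refl. Qed.

(** The eight points being distinct, the multiplicity at the i-th one is 2 if P9 coincides with it
    and 1 otherwise; the first forces dependent gradients, the second independent ones. *)
Lemma Cayley_Bacharach_jacobian (K : fieldType) (P : 8.-tuple 'rV[K]_3) (P9 : 'rV[K]_3)
    (f g : 'cV[K]_10) (i : 'I_8) (R S : 'rV[K]_3) :
  tnth P i != 0 -> general_position P -> Cayley_Bacharach_point P P9 ->
  f != 0 -> (forall k, g != k *: f) ->
  (forall j, dot (cubic_monomials (tnth P j)) f = 0) ->
  (forall j, dot (cubic_monomials (tnth P j)) g = 0) ->
  det3 (tnth P i) R S != 0 ->
  (jacobian f g (tnth P i) R S == 0) = same_point P9 (tnth P i).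
Proof.
set Q := tnth P i => Q0 [gp _ _] [_ _ CB] f0 gf fP gP D0.
have [k Qk] : exists k, Q 0 k != 0.
  apply/existsP; apply: contraNT Q0; rewrite negb_exists => /forallP h.
  by apply/eqP/rowP => k; rewrite mxE; apply/eqP; have := h k; rewrite negbK.
have [a [b [kab J]]] := jacobian_cross K k.
have inj := form_of_inj cubic_exponents_uniq.
pose F := form_of cubic_exponents f; pose G := form_of cubic_exponents g.
have thr e e0 eP := @cubic_through_form K P e e0 eP.
have hF : F \is 3.-homog by case: (thr f f0 fP) => [[]].
have g0 : g != 0 by have := gf 0; rewrite scale0r.
have hG : G \is 3.-homog by case: (thr g g0 gP) => [[]].
have FG c : G != c *: F.
  apply: contraNneq (gf c) => e; apply/eqP/inj; rewrite -/G e /F /form_of scaler_sumr.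
  by apply: eq_bigr => j _; rewrite mxE scalerA.
have F0 : F.@[Q 0] = 0 by rewrite cubic_meval fP.
have G0 : G.@[Q 0] = 0 by rewrite cubic_meval gP.
have := CB F G (thr f f0 fP) (thr g g0 gP) FG Q Q0.
have -> : #|[set j | same_point (tnth P j) Q]| = 1%N.
  apply/eqP/cards1P; exists i; apply/setP => j; rewrite !inE.
  have [->|ji] := eqVneq; first exact: same_point_refl.
  by apply/negbTE/gp.
have -> : (jacobian f g Q R S == 0) =
    (partial f Q a * partial g Q b == partial f Q b * partial g Q a).
  have e := J f g Q R S (fP i) (gP i).
  rewrite -[RHS]subr_eq0; apply/eqP/eqP => z.
    by move/eqP: e; rewrite z mul0r eq_sym mulf_eq0 (negPf D0) => /eqP.
  by apply: (mulIf Qk); rewrite e z mulr0 mul0r.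
rewrite -!cubic_mderiv -/F -/G; case: (same_point P9 Q) => /=; rewrite ?addn0 ?addn1 => im.
  by rewrite (multiplicity_ge2_tangent Qk kab hF hG F0 G0 im) eqxx.
have u : uniq [:: k; a; b] by rewrite (perm_uniq kab) enum_uniq.
exact/negbTE/eqP/(multiplicity1_transversal Qk u F0 G0 im).
Qed.

Lemma polar_lin (K : fieldType) (f g : 'cV[K]_10) (a b : K) (P R : 'rV[K]_3) :
  polar (a *: f + b *: g) P R = a * polar f P R + b * polar g P R.
Proof. by rewrite /polar !dotDr !dotZr; ring. Qed.

Lemma comb_basis (K : fieldType) (A B C : 'rV[K]_3) :
  [/\ comb A B C 1 0 0 = A, comb A B C 0 1 0 = B & comb A B C 0 0 1 = C].
Proof. by rewrite /comb !scale1r !scale0r !addr0 !add0r. Qed.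

(* If Z = 0, the member of the pencil tangent to AB at A vanishes at three more points of AB, hence
   splits off AB; the residual conic passes through C and the five points, so it is zero at A. *)
Lemma ninth_point_off_line (K : fieldType) (A B C Q4 Q5 Q6 Q7 Q8 : 'rV[K]_3)
    (f g : 'cV[K]_10) (X Y Z : K) :
  det3 A B C != 0 -> Cdet C Q4 Q5 Q6 Q7 Q8 != 0 ->
  (forall Q, Q \in [:: Q4; Q5; Q6; Q7; Q8] -> det3 Q A B != 0) ->
  (forall Q, Q \in [:: A; B; C; Q4; Q5; Q6; Q7; Q8; comb A B C X Y Z] ->
    dot (cubic_monomials Q) f = 0 /\ dot (cubic_monomials Q) g = 0) ->
  jacobian f g A B C != 0 -> X != 0 -> Y != 0 -> Z != 0.
Proof.
move=> D0 CC lQ fgQ J0 X0 Y0; apply: contraNneq J0 => Z0.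
pose e := polar g A B *: f + (- polar f A B) *: g.
have eQ Q : Q \in [:: A; B; C; Q4; Q5; Q6; Q7; Q8; comb A B C X Y Z] ->
    dot (cubic_monomials Q) e = 0.
  by move=> /fgQ[f0 g0]; rewrite dotDr !dotZr f0 g0 !mulr0 addr0.
have [m hm] := cubic_comb e A B C.
have eA : dot (cubic_monomials A) e = 0 by apply: eQ; rewrite !inE eqxx.
have eB : dot (cubic_monomials B) e = 0 by apply: eQ; rewrite !inE eqxx ?orbT.
have eC : dot (cubic_monomials C) e = 0 by apply: eQ; rewrite !inE eqxx ?orbT.
have eAB : polar e A B = 0 by rewrite polar_lin; ring.
have eAC : polar e A C = - jacobian f g A B C by rewrite polar_lin /jacobian; ring.
have eBA : polar e B A = 0.
  have : dot (cubic_monomials (comb A B C X Y Z)) e = 0 by apply: eQ; rewrite !inE eqxx ?orbT.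
  case: (hm X Y Z) => -> _; rewrite Z0 eA eB eC eAB => h.
  have : Y ^+ 2 * X * polar e B A = 0 by rewrite -[RHS]h; ring.
  by move/eqP; rewrite !mulf_eq0 (negPf X0) (negPf Y0) /= => /eqP.
(* The quotient of [e] by z, the equation of AB; its z^2 coefficient is 0 because [e] vanishes at
   C. *)
have [h hh] := conic_in_basis (polar e A C) m (polar e C A) (polar e B C) (polar e C B) 0 D0.
have hQ Q : Q \in [:: Q4; Q5; Q6; Q7; Q8] -> dot (quadratic_monomials Q) h = 0.
  move=> Qin; have Qz := lQ Q Qin; have : dot (cubic_monomials Q) e = 0.
    by apply: eQ; move: Qin; rewrite !inE; do ?case/orP; move=> ->; rewrite ?orbT.
  rewrite (combE Q D0) hh; case: (hm (det3 Q B C / det3 A B C) (det3 Q C A / det3 A B C)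
    (det3 Q A B / det3 A B C)) => -> _; rewrite eA eB eC eAB eBA => E.
  have z0 : det3 Q A B / det3 A B C != 0 by rewrite mulf_neq0 ?invr_eq0.
  by apply: (mulfI z0); rewrite mulr0 -[RHS]E; ring.
have [cA _ cC] := comb_basis A B C.
have hA : dot (quadratic_monomials (comb A B C 1 0 0)) h = polar e A C by rewrite hh; ring.
have hC : dot (quadratic_monomials (comb A B C 0 0 1)) h = 0 by rewrite hh; ring.
rewrite cA in hA; rewrite cC in hC.
have /eqP := conic_values_ratio A C hQ.
by rewrite hA hC mul0r mulf_eq0 (negPf CC) orbF eAC oppr_eq0.
Qed.

(** The conic is the determinant of the linear cofactors of f and g. At a common zero other than P9
    the two conics do not both vanish, so their values are a nonzero kernel vector. At P9 itself the
    determinant is the Jacobian times -Y Z. *)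
Lemma conic_through_residual_points (K : fieldType) (A B C Q4 Q5 Q6 Q7 Q8 : 'rV[K]_3)
    (f g : 'cV[K]_10) (X Y Z : K) :
  let P9 := comb A B C X Y Z in
  det3 A B C != 0 -> X != 0 -> Y != 0 -> Z != 0 ->
  (forall Q, Q \in [:: Q4; Q5; Q6; Q7; Q8] ->
    [/\ det3 Q B C != 0, det3 Q C A != 0 & det3 Q A B != 0]) ->
  (forall Q, Q \in [:: A; B; C; Q4; Q5; Q6; Q7; Q8; P9] ->
    dot (cubic_monomials Q) f = 0 /\ dot (cubic_monomials Q) g = 0) ->
  (forall Q, Q \in [:: Q4; Q5; Q6; Q7; Q8] ->
    ~~ same_point Q P9 \/ Q = P9 /\ jacobian f g P9 B C = 0) ->
  exists h : 'cV[K]_6,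
    [/\ forall Q, Q \in [:: Q4; Q5; Q6; Q7; Q8] -> dot (quadratic_monomials Q) h = 0,
        dot (quadratic_monomials A) h = X * Y * Z * (X * jacobian f g A B C),
        dot (quadratic_monomials B) h = X * Y * Z * (Y * jacobian f g B C A)
      & dot (quadratic_monomials C) h = X * Y * Z * (Z * jacobian f g C A B)].
Proof.
move=> P9 D0 X0 Y0 Z0 lQ fgQ tQ.
have [m hm] := cubic_comb f A B C; have [n hn] := cubic_comb g A B C.
have [fA gA] : dot (cubic_monomials A) f = 0 /\ dot (cubic_monomials A) g = 0.
  by apply: fgQ; rewrite !inE eqxx.
have [fB gB] : dot (cubic_monomials B) f = 0 /\ dot (cubic_monomials B) g = 0.
  by apply: fgQ; rewrite !inE eqxx ?orbT.
have [fC gC] : dot (cubic_monomials C) f = 0 /\ dot (cubic_monomials C) g = 0.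
  by apply: fgQ; rewrite !inE eqxx ?orbT.
pose F := cubic_in_basis (polar f A B) (polar f A C) (polar f B A) (polar f B C)
  (polar f C A) (polar f C B) m.
pose G := cubic_in_basis (polar g A B) (polar g A C) (polar g B A) (polar g B C)
  (polar g C A) (polar g C B) n.
have eF x y z : dot (cubic_monomials (comb A B C x y z)) f = F x y z.
  by case: (hm x y z) => -> _; rewrite fA fB fC /F /cubic_in_basis; ring.
have eG x y z : dot (cubic_monomials (comb A B C x y z)) g = G x y z.
  by case: (hn x y z) => -> _; rewrite gA gB gC /G /cubic_in_basis; ring.
have [FP GP] : F X Y Z = 0 /\ G X Y Z = 0.
  by rewrite -eF -eG; apply: fgQ; rewrite !inE eqxx ?orbT.
pose l := cofactor1 (polar f A B) (polar f B A) (polar f C A) (polar f C B) X Y Z.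
pose l' := cofactor2 (polar f A C) (polar f B A) (polar f B C) (polar f C A) X Y Z.
pose k := cofactor1 (polar g A B) (polar g B A) (polar g C A) (polar g C B) X Y Z.
pose k' := cofactor2 (polar g A C) (polar g B A) (polar g B C) (polar g C A) X Y Z.
pose q x y z := l x y z * k' x y z - l' x y z * k x y z.
have [h hq] : exists h : 'cV[K]_6, forall x y z,
    dot (quadratic_monomials (comb A B C x y z)) h = q x y z.
  pose lx := X * Y * polar f A B. pose ly := X * Y * polar f B A.
  pose lz := - (polar f C A * X + polar f C B * Y) * Z.
  pose lx' := X * Z * polar f A C. pose ly' := - (polar f B A * X + polar f B C * Z) * Y.
  pose lz' := X * Z * polar f C A.
  pose kx := X * Y * polar g A B. pose ky := X * Y * polar g B A.
  pose kz := - (polar g C A * X + polar g C B * Y) * Z.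
  pose kx' := X * Z * polar g A C. pose ky' := - (polar g B A * X + polar g B C * Z) * Y.
  pose kz' := X * Z * polar g C A.
  have [h hh] := conic_in_basis (lx * kx' - lx' * kx)
    (lx * ky' + ly * kx' - lx' * ky - ly' * kx) (lx * kz' + lz * kx' - lx' * kz - lz' * kx)
    (ly * ky' - ly' * ky) (ly * kz' + lz * ky' - ly' * kz - lz' * ky) (lz * kz' - lz' * kz) D0.
  exists h => x y z; rewrite hh /q /l /l' /k /k' /cofactor1 /cofactor2.
  by rewrite /lx /ly /lz /lx' /ly' /lz' /kx /ky /kz /kx' /ky' /kz'; ring.
have [cA cB cC] := comb_basis A B C.
exists h; split=> [Q Qin|||].
- have [fQ gQ] : dot (cubic_monomials Q) f = 0 /\ dot (cubic_monomials Q) g = 0.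
    by apply: fgQ; move: Qin; rewrite !inE; do ?case/orP; move=> ->; rewrite ?orbT.
  have [nx ny nz] := lQ Q Qin.
  case: (tQ Q Qin) => [|[-> J0]]; last first.
    (* Each cofactor at (X, Y, Z), plus Z or Y times a polar at P9, is the value of the cubic at P9,
       hence zero. *)
    rewrite hq /q (_ : l X Y Z = - (Z * polar f P9 C)); last first.
      apply/eqP; rewrite -subr_eq0 opprK; apply/eqP; rewrite -[RHS]FP.
      by have [_ [_ ->]] := hm X Y Z; rewrite fC /l /F /cofactor1 /cubic_in_basis; ring.
    rewrite (_ : l' X Y Z = - (Y * polar f P9 B)); last first.
      apply/eqP; rewrite -subr_eq0 opprK; apply/eqP; rewrite -[RHS]FP.
      by have [_ [-> _]] := hm X Y Z; rewrite fB /l' /F /cofactor2 /cubic_in_basis; ring.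
    rewrite (_ : k X Y Z = - (Z * polar g P9 C)); last first.
      apply/eqP; rewrite -subr_eq0 opprK; apply/eqP; rewrite -[RHS]GP.
      by have [_ [_ ->]] := hn X Y Z; rewrite gC /k /G /cofactor1 /cubic_in_basis; ring.
    rewrite (_ : k' X Y Z = - (Y * polar g P9 B)); last first.
      apply/eqP; rewrite -subr_eq0 opprK; apply/eqP; rewrite -[RHS]GP.
      by have [_ [-> _]] := hn X Y Z; rewrite gB /k' /G /cofactor2 /cubic_in_basis; ring.
    transitivity (- (Y * Z) * jacobian f g P9 B C); first by rewrite /jacobian; ring.
    by rewrite J0 mulr0.
  rewrite (combE Q D0) in fQ gQ *; rewrite hq.
  set x := det3 Q B C / _ in fQ gQ *; set y := det3 Q C A / _ in fQ gQ *.
  set z := det3 Q A B / _ in fQ gQ *.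
  rewrite eF in fQ; rewrite eG in gQ => nPQ.
  have x0 : x != 0 by rewrite mulf_neq0 ?invr_eq0.
  have y0 : y != 0 by rewrite mulf_neq0 ?invr_eq0.
  have z0 : z != 0 by rewrite mulf_neq0 ?invr_eq0.
  clearbody x y z; apply: det2_kernel (cofactor_decomp FP fQ) (cofactor_decomp GP gQ).
  (* Off the lines y = 0 and z = 0, simultaneous vanishing of the two conics makes (x, y, z)
     proportional to (X, Y, Z). *)
  rewrite -negb_and; apply: contra nPQ.
  rewrite !mulf_eq0 (negPf y0) (negPf z0) !subr_eq0 /= => /andP[/eqP xZ /eqP xY].
  have -> : comb A B C x y z = (x / X) *: P9.
    rewrite /P9 /comb !scalerDr !scalerA divfK //.
    by rewrite mulrAC xY mulfK // mulrAC xZ mulfK.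
  by rewrite same_point_sym same_point_scale ?same_point_refl // mulf_neq0 ?invr_eq0.
- rewrite -[X in quadratic_monomials X]cA hq /q /l /l' /k /k' /cofactor1 /cofactor2 /jacobian; ring.
- rewrite -[X in quadratic_monomials X]cB hq /q /l /l' /k /k' /cofactor1 /cofactor2 /jacobian; ring.
- rewrite -[X in quadratic_monomials X]cC hq /q /l /l' /k /k' /cofactor1 /cofactor2 /jacobian; ring.
Qed.

(** With Z = 0 the point S would lie on AB and, being neither A nor B, have X and Y nonzero, against
    [ninth_point_off_line]. *)
Lemma ninth_point_coordinate (K : fieldType) (A B C Q4 Q5 Q6 Q7 Q8 : 'rV[K]_3)
    (f g : 'cV[K]_10) (X Y Z : K) :
  let S := comb A B C X Y Z in
  det3 A B C != 0 -> Cdet C Q4 Q5 Q6 Q7 Q8 != 0 ->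
  (forall Q, Q \in [:: Q4; Q5; Q6; Q7; Q8] -> det3 Q A B != 0) ->
  (forall Q, Q \in [:: A; B; C; Q4; Q5; Q6; Q7; Q8; S] ->
    dot (cubic_monomials Q) f = 0 /\ dot (cubic_monomials Q) g = 0) ->
  jacobian f g A B C != 0 ->
  S != 0 -> ~~ same_point S A -> ~~ same_point S B -> Z != 0.
Proof.
move=> S D0 CC lQ fgQ J0 S0 SA SB; apply/negP => /eqP Z0.
have X0 : X != 0.
  apply: contraNneq SB => X0; move: S0; rewrite /S /comb X0 Z0 !scale0r add0r addr0 => S0.
  have Y0 : Y != 0 by apply: contraNneq S0 => ->; rewrite scale0r.
  by rewrite same_point_sym same_point_scale ?same_point_refl.
have Y0 : Y != 0.
  apply: contraNneq SA => Y0; move: S0; rewrite /S /comb Y0 Z0 !scale0r !addr0 => S0.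
  by rewrite same_point_sym same_point_scale ?same_point_refl.
by have := ninth_point_off_line D0 CC lQ fgQ J0 X0 Y0; rewrite Z0 eqxx.
Qed.

(** Shows that the dual columns f, g for one order of P1, P2, P3 are also dual for the rotated
    orders. *)
Lemma evaluation_mx_mul (K : fieldType) (P1 P2 P3 P4 P5 P6 P7 P8 : 'rV[K]_3)
    (w1 w2 : 'rV[K]_10) (e : 'cV[K]_10) :
  (forall Q, Q \in [:: P1; P2; P3; P4; P5; P6; P7; P8] -> dot (cubic_monomials Q) e = 0) ->
  evaluation_mx P1 P2 P3 P4 P5 P6 P7 P8 w1 w2 *m e =
  dot w1 e *: delta_mx 8 0 + dot w2 e *: delta_mx 9 0.
Proof.
move=> eP; apply/row_matrixP => i; rewrite row_mul rowK; apply/rowP => j.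
rewrite (ord1 j) -[LHS]/(dot _ e) !mxE andbT.
case: i => -[|[|[|[|[|[|[|[|[|[|//]]]]]]]]]] lt; rewrite (tnth_nth 0) /=.
1-8: by rewrite eP ?mulr0 ?addr0 // !inE eqxx ?orbT.
- by rewrite mulr1 mulr0 addr0.
- by rewrite mulr1 mulr0 add0r.
Qed.

Theorem theorem3 (K : fieldType) (charK : 3%N \notin [pchar K])
    (P1 P2 P3 P4 P5 P6 P7 P8 P9 : 'rV[K]_3) :
  let P := [tuple P1; P2; P3; P4; P5; P6; P7; P8] in
  let Cx := Cdet P1 P4 P5 P6 P7 P8 in
  let Cy := Cdet P2 P4 P5 P6 P7 P8 in
  let Cz := Cdet P3 P4 P5 P6 P7 P8 in
  let Dx := Ddet P1 P2 P3 P4 P5 P6 P7 P8 in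
  let Dy := Ddet P2 P3 P1 P4 P5 P6 P7 P8 in
  let Dz := Ddet P3 P1 P2 P4 P5 P6 P7 P8 in
  (forall i : 'I_8, tnth P i != 0) ->
  general_position P ->
  Cayley_Bacharach_point P P9 ->
  same_point P9 ((Cx * Dy * Dz) *: P1 + (Dx * Cy * Dz) *: P2
                 + (Dx * Dy * Cz) *: P3).
Proof.
move=> P Cx Cy Cz Dx Dy Dz hP gp CB.
have three0 : 3 != 0 :> K by move: charK; rewrite inE.
have [w1 [w2 uW]] := evaluation_mx_unit gp; set W := evaluation_mx _ _ _ _ _ _ _ _ _ _ in uW.
pose f : 'cV[K]_10 := invmx W *m delta_mx 8 0.
pose g : 'cV[K]_10 := invmx W *m delta_mx 9 0.
have Wf : W *m f = delta_mx 8 0 by rewrite mulKVmx.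
have Wg : W *m g = delta_mx 9 0 by rewrite mulKVmx.
have Wdot k (e : 'cV[K]_10) : W *m e = delta_mx k 0 ->
    forall i, dot (row i W) e = (i == k)%:R.
  by move=> We i; rewrite /dot -row_mul We !mxE andbT.
have dotW (e : 'cV[K]_10) : (forall i : 'I_10, (i < 8)%N -> dot (row i W) e = 0) ->
    forall j, dot (cubic_monomials (tnth P j)) e = 0.
  move=> We j.
  have [i lti ->] : exists2 i : 'I_10, (i < 8)%N & cubic_monomials (tnth P j) = row i W.
    case: j => -[|[|[|[|[|[|[|[|//]]]]]]]] lt.
    - by exists 7; rewrite // rowK !(tnth_nth 0).
    - by exists 0; rewrite // rowK !(tnth_nth 0).
    - by exists 1; rewrite // rowK !(tnth_nth 0).
    - by exists 2; rewrite // rowK !(tnth_nth 0).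
    - by exists 3; rewrite // rowK !(tnth_nth 0).
    - by exists 4; rewrite // rowK !(tnth_nth 0).
    - by exists 5; rewrite // rowK !(tnth_nth 0).
    - by exists 6; rewrite // rowK !(tnth_nth 0).
  exact: We.
have fP j : dot (cubic_monomials (tnth P j)) f = 0.
  apply: dotW => i lt; rewrite (Wdot _ _ Wf).
  by case: eqP lt => // ->.
have gP j : dot (cubic_monomials (tnth P j)) g = 0.
  apply: dotW => i lt; rewrite (Wdot _ _ Wg).
  by case: eqP lt => // ->.
have w1E k e : W *m e = delta_mx k 0 -> dot w1 e = (8 == k)%:R.
  by move=> We; rewrite -(Wdot _ _ We 8) rowK.
have w2E k e : W *m e = delta_mx k 0 -> dot w2 e = (9 == k)%:R.
  by move=> We; rewrite -(Wdot _ _ We 9) rowK.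
have f0 : f != 0.
  by apply/eqP => f0; have := w1E _ _ Wf; rewrite f0 /dot mulmx0 mxE => /esym/eqP; rewrite oner_eq0.
have gf k : g != k *: f.
  apply/eqP => gkf; have := w2E _ _ Wg; rewrite gkf dotZr (w2E _ _ Wf) mulr0.
  by move=> /esym/eqP; rewrite oner_eq0.
have g0 : g != 0 by have := gf 0; rewrite scale0r.
have inP Q : Q \in [:: P1; P2; P3; P4; P5; P6; P7; P8] -> exists j, Q = tnth P j.
  by move=> /(nthP 0)[j lt <-]; exists (Ordinal lt); rewrite (tnth_nth 0).
have fQ Q : Q \in [:: P1; P2; P3; P4; P5; P6; P7; P8] -> dot (cubic_monomials Q) f = 0.
  by move=> /inP[j ->].
have gQ Q : Q \in [:: P1; P2; P3; P4; P5; P6; P7; P8] -> dot (cubic_monomials Q) g = 0.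
  by move=> /inP[j ->].
have D123 : det3 P1 P2 P3 != 0 := @three_not_on_line K P 0 1 2 gp isT.
have D231 : det3 P2 P3 P1 != 0 by rewrite det3_rot.
have D312 : det3 P3 P1 P2 != 0 by rewrite 2!det3_rot.
have Cx0 : Cx != 0 := @six_not_on_conic K P 0 3 4 5 6 7 gp isT.
have Cy0 : Cy != 0 := @six_not_on_conic K P 1 3 4 5 6 7 gp isT.
have Cz0 : Cz != 0 := @six_not_on_conic K P 2 3 4 5 6 7 gp isT.
pose j1 := jacobian f g P1 P2 P3; pose j2 := jacobian f g P2 P3 P1.
pose j3 := jacobian f g P3 P1 P2.
pose mu := 3 * \det W / det3 P1 P2 P3.
have mu0 : mu != 0.
  by rewrite !mulf_neq0 ?invr_eq0 //; move: uW; rewrite unitmxE unitfE.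
have DJ A B C : evaluation_mx A B C P4 P5 P6 P7 P8 w1 w2 \in unitmx ->
    \det (evaluation_mx A B C P4 P5 P6 P7 P8 w1 w2) = \det W -> det3 A B C = det3 P1 P2 P3 ->
    perm_eq [:: A; B; C; P4; P5; P6; P7; P8] [:: P1; P2; P3; P4; P5; P6; P7; P8] ->
    Ddet A B C P4 P5 P6 P7 P8 = mu * jacobian f g A B C.
  move=> u dW dD pe; apply: (mulIf D123); rewrite -{1}dD (Ddet_jacobian (f := f) (g := g) B C u).
  - by rewrite dW /mu; field.
  - rewrite evaluation_mx_mul => [|Q]; last by rewrite (perm_mem pe) => /fQ.
    by rewrite (w1E _ _ Wf) (w2E _ _ Wf) scale1r scale0r addr0.
  - rewrite evaluation_mx_mul => [|Q]; last by rewrite (perm_mem pe) => /gQ.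
    by rewrite (w1E _ _ Wg) (w2E _ _ Wg) scale1r scale0r add0r.
clearbody mu.
have dW2 : \det (evaluation_mx P2 P3 P1 P4 P5 P6 P7 P8 w1 w2) = \det W.
  by rewrite det_evaluation_mx_rot.
have dW3 : \det (evaluation_mx P3 P1 P2 P4 P5 P6 P7 P8 w1 w2) = \det W.
  by rewrite -dW2 det_evaluation_mx_rot.
have uW2 : evaluation_mx P2 P3 P1 P4 P5 P6 P7 P8 w1 w2 \in unitmx by rewrite unitmxE dW2 -unitmxE.
have uW3 : evaluation_mx P3 P1 P2 P4 P5 P6 P7 P8 w1 w2 \in unitmx by rewrite unitmxE dW3 -unitmxE.
have pe2 : perm_eq [:: P2; P3; P1; P4; P5; P6; P7; P8] [:: P1; P2; P3; P4; P5; P6; P7; P8].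
  exact/permPl/(perm_catCA [:: P2; P3] [:: P1]).
have pe3 : perm_eq [:: P3; P1; P2; P4; P5; P6; P7; P8] [:: P1; P2; P3; P4; P5; P6; P7; P8].
  exact/permPl/(perm_catCA [:: P3] [:: P1; P2]).
have eDx : Dx = mu * j1 by apply: DJ.
have eDy : Dy = mu * j2.
  by apply: DJ; rewrite // det3_rot.
have eDz : Dz = mu * j3.
  by apply: DJ; rewrite // 2!det3_rot.
have J i R S := Cayley_Bacharach_jacobian (R := R) (S := S) (hP i) gp CB f0 gf fP gP.
have s1 : (j1 == 0) = same_point P9 P1 := J 0 P2 P3 D123.
have s2 : (j2 == 0) = same_point P9 P2 := J 1 P3 P1 D231.
have s3 : (j3 == 0) = same_point P9 P3 := J 2 P1 P2 D312.
have ns (i k : 'I_8) : i != k -> same_point P9 (tnth P i) -> same_point P9 (tnth P k) = false.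
  move=> ik h; apply/negP => h'; case: gp => gp1 _ _.
  by case/negP: (gp1 _ _ ik); apply: same_point_trans h'; rewrite same_point_sym.
(* If P9 is one of P1, P2, P3, the corresponding D vanishes and kills the other two terms of the
   formula. *)
have [s1t|s1f] := boolP (same_point P9 P1).
  have j1_0 : j1 = 0 by apply/eqP; rewrite s1.
  have j2_0 : j2 != 0 by rewrite s2; exact/negbT/(ns 0 1).
  have j3_0 : j3 != 0 by rewrite s3; exact/negbT/(ns 0 2).
  rewrite eDx eDy eDz j1_0 mulr0 !mul0r !scale0r !addr0 same_point_scale //.
  by rewrite !mulf_neq0.
have [s2t|s2f] := boolP (same_point P9 P2).
  have j2_0 : j2 = 0 by apply/eqP; rewrite s2.
  have j1_0 : j1 != 0 by rewrite s1.
  have j3_0 : j3 != 0 by rewrite s3; exact/negbT/(ns 1 2).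
  rewrite eDx eDy eDz j2_0 !mulr0 !mul0r !scale0r addr0 add0r same_point_scale //.
  by rewrite !mulf_neq0.
have [s3t|s3f] := boolP (same_point P9 P3).
  have j3_0 : j3 = 0 by apply/eqP; rewrite s3.
  have j1_0 : j1 != 0 by rewrite s1.
  have j2_0 : j2 != 0 by rewrite s2.
  rewrite eDx eDy eDz j3_0 !mulr0 !scale0r !add0r same_point_scale //.
  by rewrite !mulf_neq0.
have in5 Q : Q \in [:: P4; P5; P6; P7; P8] -> exists2 j, Q = tnth P j & (2 < j)%N.
  move=> /(nthP 0)[j lt <-]; have lt' : (j.+3 < 8)%N by [].
  by exists (Ordinal lt'); rewrite // (tnth_nth 0).
(* A representative S of P9 that is literally P_k if P9 coincides with P_k for some k > 3. *)
have [S [S9 fgS tS]] : exists S, [/\ same_point P9 S,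
    dot (cubic_monomials S) f = 0 /\ dot (cubic_monomials S) g = 0
    & forall Q, Q \in [:: P4; P5; P6; P7; P8] ->
      ~~ same_point Q S \/ Q = S /\ jacobian f g S P2 P3 = 0].
  have [/hasP[Q Qin Q9]|/hasPn no] := boolP (has (same_point P9) [:: P4; P5; P6; P7; P8]).
    have [k Qk gtk] := in5 _ Qin; exists Q; rewrite Qk in Q9 *; split=> // R /in5[j -> gtj].
    have [->|jk] := eqVneq j k.
      right; split=> //; apply/eqP; rewrite J //.
      apply: (@three_not_on_line K P k 1 2 gp).
      by case: k gtk {Qk Q9} => -[|[|[|k]]].
    by left; case: gp => gp1 _ _; apply: gp1.
  exists P9; split; first exact: same_point_refl.
    case: CB => _ pass _.
    by split; rewrite -cubic_meval; apply: pass; apply: cubic_through_form.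
  by move=> Q /no Q9; left; rewrite same_point_sym.
have S0 : S != 0.
  case: CB => P90 _ _; apply: contraNneq P90 => S0; move: S9.
  by rewrite /same_point S0 => /andP[/submx0null ->].
have tri (A B : 'I_8) : (A < 3)%N -> (B < 3)%N -> A != B ->
    forall Q, Q \in [:: P4; P5; P6; P7; P8] -> det3 Q (tnth P A) (tnth P B) != 0.
  move=> A3 B3 AB Q /in5[j -> gtj]; apply: three_not_on_line => //=.
  rewrite !inE AB negb_or !andbT.
  by apply/andP; split; apply/eqP => e; move: gtj; rewrite e ltnNge -ltnS ?A3 ?B3.
have Ssame Q : same_point S Q = same_point P9 Q.
  apply/idP/idP; first exact: same_point_trans.
  by apply: same_point_trans; rewrite same_point_sym.
have eS := combE S D123.
set X := det3 S P2 P3 / _ in eS; set Y := det3 S P3 P1 / _ in eS.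
set Z := det3 S P1 P2 / _ in eS; clearbody X Y Z.
have fgQ A B C x y z : S = comb A B C x y z ->
    perm_eq [:: A; B; C; P4; P5; P6; P7; P8] [:: P1; P2; P3; P4; P5; P6; P7; P8] ->
    forall Q, Q \in [:: A; B; C; P4; P5; P6; P7; P8; comb A B C x y z] ->
    dot (cubic_monomials Q) f = 0 /\ dot (cubic_monomials Q) g = 0.
  move=> <- pe Q; rewrite -[X in _ \in X]/(rcons [:: A; B; C; P4; P5; P6; P7; P8] S).
  by rewrite mem_rcons inE (perm_mem pe) => /orP[/eqP->|Qin] //; rewrite fQ ?gQ.
have coord A B C x y z : S = comb A B C x y z ->
    perm_eq [:: A; B; C; P4; P5; P6; P7; P8] [:: P1; P2; P3; P4; P5; P6; P7; P8] ->
    det3 A B C != 0 -> Cdet C P4 P5 P6 P7 P8 != 0 ->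
    (forall Q, Q \in [:: P4; P5; P6; P7; P8] -> det3 Q A B != 0) ->
    jacobian f g A B C != 0 -> ~~ same_point P9 A -> ~~ same_point P9 B -> z != 0.
  move=> eSc pe dD cC tQ J0; rewrite -!Ssame => SA SB.
  have := ninth_point_coordinate dD cC tQ (fgQ _ _ _ _ _ _ eSc pe) J0; rewrite -eSc.
  by apply.
have Z0 : Z != 0.
  apply: (coord _ _ _ _ _ _ eS _ D123 Cz0) => //; last by rewrite s1.
  exact: (tri 0 1 isT isT isT).
have X0 : X != 0.
  apply: (coord P2 P3 P1 Y Z X _ pe2 D231 Cx0) => //.
  - by rewrite -comb_rot.
  - exact: (tri 1 2 isT isT isT).
  - by rewrite s2.
have Y0 : Y != 0.
  apply: (coord P3 P1 P2 Z X Y _ pe3 D312 Cy0) => //.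
  - by rewrite comb_rot.
  - exact: (tri 2 0 isT isT isT).
  - by rewrite s3.
have [h [hQ hA hB hC]] : exists h : 'cV[K]_6,
    [/\ forall Q, Q \in [:: P4; P5; P6; P7; P8] -> dot (quadratic_monomials Q) h = 0,
        dot (quadratic_monomials P1) h = X * Y * Z * (X * j1),
        dot (quadratic_monomials P2) h = X * Y * Z * (Y * j2)
      & dot (quadratic_monomials P3) h = X * Y * Z * (Z * j3)].
  apply: conic_through_residual_points => //.
  - move=> Q Qin.
    by split; [exact: (tri 1 2)|exact: (tri 2 0)|exact: (tri 0 1)].
  - exact: fgQ.
  - by rewrite -eS.
have XYZ0 : X * Y * Z != 0 by rewrite !mulf_neq0.
have j10 : j1 != 0 by rewrite s1.
have eCy : X * j1 * Cy = Y * j2 * Cx.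
  apply: (mulfI XYZ0); rewrite !mulrA; have := conic_values_ratio P1 P2 hQ.
  by rewrite hA hB !mulrA.
have eCz : X * j1 * Cz = Z * j3 * Cx.
  apply: (mulfI XYZ0); rewrite !mulrA; have := conic_values_ratio P1 P3 hQ.
  by rewrite hA hC !mulrA.
have Xj : X * j1 != 0 by rewrite mulf_neq0.
(* By [eCy] and [eCz], Cx / (X j1) is the common ratio of Cx, Cy, Cz to X j1, Y j2, Z j3; each term
   of the formula also has two factors mu. *)
pose c := Cx / (X * j1) * mu ^+ 2 * j1 * j2 * j3.
have -> : Cx * Dy * Dz *: P1 + Dx * Cy * Dz *: P2 + Dx * Dy * Cz *: P3 = c *: S.
  have -> : Cy = Y * j2 * Cx / (X * j1) by rewrite -eCy mulrC mulKf.
  have -> : Cz = Z * j3 * Cx / (X * j1) by rewrite -eCz mulrC mulKf.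
  rewrite eDx eDy eDz eS /comb !scalerDr !scalerA /c.
  by congr (_ *: _ + _ *: _ + _ *: _); field; rewrite X0 j10.
rewrite same_point_scale // /c !mulf_neq0 ?expf_neq0 ?invr_eq0 //; first by rewrite s2.
by rewrite s3.
Qed.
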